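(* Let $T$ be a Pisot automorphism of $\mathbb{T}^m$ given by a matrix $M\in GL(m,\mathbb{Z})$, with associated Pisot unit $\beta$. Assume: (1) $T$ is algebraically conjugate to $T_\beta$, i.e. there exists $C\in GL(m,\mathbb{Z})$ with $CM=M_\beta C$; (2) $\mathbf{t}\in\mathbb{T}^m$ is a fundamental homoclinic point for $T$; (3) $\beta$ is weakly finitary. Then the mapping $\varphi_{\mathbf{t}}:X_\beta\to\mathbb{T}^m$, $\varphi_{\mathbf{t}}(\bar\varepsilon)=\sum_{k\in\mathbb{Z}}\varepsilon_kT^{-k}\mathbf{t}$, is bijective a.e. with respect to the Haar measure on $\mathbb{T}^m$, i.e. $\#\varphi_{\mathbf{t}}^{-1}(x)=1$ for Haar-almost every $x\in\mathbb{T}^m$.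
   Context: A Pisot number is a real algebraic integer $\beta>1$ all of whose other Galois conjugates have modulus less than 1. A Pisot automorphism $T$ of $\mathbb{T}^m=\mathbb{R}^m/\mathbb{Z}^m$ is $x\mapsto Mx \bmod \mathbb{Z}^m$ with $M\in GL(m,\mathbb{Z})$ whose characteristic polynomial is irreducible over $\mathbb{Q}$ and has a Pisot number $\beta$ as a root; $\beta$ is then a unit ($\det M=\pm1$). Write the minimal polynomial of $\beta$ as $x^m-k_1x^{m-1}-\cdots-k_m$. The companion matrix $M_\beta$ has first row $(k_1,k_2,\dots,k_m)$, entries $1$ immediately below the diagonal (positions $(i+1,i)$), and zeros elsewhere; $T_\beta$ is the automorphism of $\mathbb{T}^m$ given by $M_\beta$. $\beta$-expansions and the $\beta$-compactum. For $x\in[0,1)$ the $\beta$-expansion $x=\sum_{k\ge1}\varepsilon_k\beta^{-k}$ is the greedy one: $\varepsilon_k=[\beta\tau^{k-1}(x)]$, where $\tau(x)=\beta x \bmod 1$. For $x\ge 1$ it is extended as for decimal expansions (expand $\beta^{-n}x\in[0,1)$ and shift). $Fin(\beta)$ is the set of $x\ge0$ whose $\beta$-expansion is finite (only finitely many nonzero digits). Let $d'_1=[\beta]$, $d'_n=[\beta\tau^{n-1}(1)]$ ($n\ge 2$), with $\tau(1)=\beta-[\beta]$. If $(d'_n)$ has infinitely many nonzero terms put $d_n=d'_n$; otherwise, with $k=\max\{j:d'_j>0\}$, let $(d_n)_{n\ge1}$ be the purely periodic sequence with period $(d'_1,\dots,d'_{k-1},d'_k-1)$. With $\prec$ the strict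 lexicographic order, the two-sided $\beta$-compactum is $$X_\beta=\{(\varepsilon_n)_{n\in\mathbb{Z}}:\varepsilon_n\in\{0,1,\dots,[\beta]\},\ (\varepsilon_n,\varepsilon_{n+1},\dots)\prec(d_1,d_2,\dots)\ \text{for all } n\in\mathbb{Z}\}.$$ A Pisot unit $\beta$ is weakly finitary if for every $\delta>0$ and every $x\in\mathbb{Z}[\beta]\cap[0,\infty)$ there exists $f\in Fin(\beta)\cap[0,\delta)$ such that $x+f\in Fin(\beta)$. A point $\mathbf{t}\in\mathbb{T}^m$ is homoclinic (to $\mathbf 0$) for $T$ if $T^n\mathbf{t}\to\mathbf{0}$ as $n\to\pm\infty$; the homoclinic points form a group $\mathcal{H}(T)$. A homoclinic point $\mathbf{t}$ is fundamental if the subgroup generated by $\{T^n\mathbf{t}:n\in\mathbb{Z}\}$ equals $\mathcal{H}(T)$. The convergence $T^n\mathbf t\to\mathbf 0$ is exponentially fast, so the series defining $\varphi_{\mathbf{t}}$ converges. *)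

(* Defs.v *)
From HB Require Import structures.
From mathcomp Require Import all_boot all_order all_algebra.
From mathcomp Require Import ring_quotient complex.
From mathcomp Require Import all_classical all_reals all_analysis.

Set Implicit Arguments.
Unset Strict Implicit.
Unset Printing Implicit Defensive.

Import Order.TTheory GRing.Theory Num.Theory.
Import numFieldNormedType.Exports.

Local Open Scope classical_set_scope.
Local Open Scope ring_scope.
Local Open Scope quotient_scope.

(* The m-torus R^m / Z^m, with the quotient group structure, the quotient
   topology and the Borel sigma-algebra. *)
Section Torus.
Context (R : realType) (m : nat).

Definition Zlattice : {pred 'cV[R]_m} :=
  fun x => x \is a mxOver (@Num.int R).

Fact Zlattice_zmod_closed : zmod_closed Zlattice.
Proof.
split=> [|x y xZ yZ]; first by apply/mxOverP => i j; rewrite mxE rpred0.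
by apply/mxOverP => i j; rewrite !mxE rpredB//; apply/mxOverP.
Qed.
HB.instance Definition _ :=
  GRing.isZmodClosed.Build _ Zlattice Zlattice_zmod_closed.

Definition torus : Type := quotient_topology (Quotient.quot Zlattice).

HB.instance Definition _ := PointedTopological.on torus.
HB.instance Definition _ := Quotient.on torus.
HB.instance Definition _ := GRing.isZmodule.Build torus
  (@Quotient.addqA _ Zlattice) (@Quotient.addqC _ Zlattice)
  (@Quotient.add0q _ Zlattice) (@Quotient.addNq _ Zlattice).
HB.instance Definition _ :=
  Measurable.copy torus (g_sigma_algebraType (@open torus)).

Definition to_torus (x : 'cV[R]_m) : torus := \pi_torus x.

(* On a compact group the Haar measure (normalised to total mass 1) is the
   unique translation-invariant Borel probability measure. *)
Definition is_haar (mu : probability torus R) : Prop :=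
  forall (a : torus) (A : set torus),
    measurable A -> mu [set a + x | x in A] = mu A.

(* Well defined on classes, as A has integer entries. *)
Definition toral_map (A : 'M[int]_m) (x : torus) : torus :=
  to_torus (map_mx intr A *m repr x).

(* T^n for n : int, where T is the automorphism given by A \in GL(m, Z). *)
Definition toral_iter (A : 'M[int]_m) (n : int) (x : torus) : torus :=
  match n with
  | Posz k => iter k (toral_map A) x
  | Negz k => iter k.+1 (toral_map (invmx A)) x
  end.

Definition homoclinic (A : 'M[int]_m) : set torus :=
  [set t | (toral_iter A k%:Z t @[k --> \oo] --> (0 : torus)) /\
           (toral_iter A (- k%:Z) t @[k --> \oo] --> (0 : torus))].

Definition subgroup_set (H : set torus) : Prop :=
  H 0 /\ forall x y, H x -> H y -> H (x - y).

Definition generated_subgroup (S : set torus) : set torus :=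
  smallest subgroup_set S.

Definition fundamental_homoclinic (A : 'M[int]_m) (t : torus) : Prop :=
  homoclinic A t /\
  generated_subgroup [set toral_iter A n t | n in [set: int]] = homoclinic A.

(* The bilateral series \sum_(k in Z) e_k T^(-k) t, as the sum of its halves
   k >= 0 and k < 0. *)
Definition phi (A : 'M[int]_m) (t : torus) (e : int -> nat) : torus :=
  limn (series (fun k : nat => toral_iter A (- k%:Z) t *+ e k%:Z)) +
  limn (series (fun k : nat => toral_iter A k.+1%:Z t *+ e (- k.+1%:Z))).

End Torus.

Section Pisot.
Context (R : realType).

Definition is_min_poly (p : {poly rat}) (b : R) : Prop :=
  [/\ p \is monic, irreducible_poly p & root (map_poly ratr p) b].

Definition galois_conjugate (b : R) (z : R[i]) : Prop :=
  exists p : {poly rat}, is_min_poly p b /\ root (map_poly ratr p) z.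

Definition pisot_number (b : R) : Prop :=
  [/\ 1 < b,
      integralOver (intr : int -> R) b &
      forall z : R[i], galois_conjugate b z -> z != b%:C%C -> `|z| < 1].

Definition pisot_automorphism (m : nat) (M : 'M[int]_m) (b : R) : Prop :=
  [/\ M \in unitmx,
      irreducible_poly (map_poly intr (char_poly M) : {poly rat}),
      root (map_poly intr (char_poly M)) b &
      pisot_number b].

(* 'X^m - k_1 'X^(m-1) - ... - k_m, where [k i] stands for k_(i+1). *)
Definition beta_poly (m : nat) (k : 'I_m -> int) : {poly rat} :=
  'X^m - \sum_(i < m) (k i)%:~R *: 'X^(m - i.+1).

Definition beta_mx (m : nat) (k : 'I_m -> int) : 'M[int]_m :=
  \matrix_(i, j) if val i == 0%N then k j else (val i == (val j).+1)%:R.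

End Pisot.

Definition algebraically_conjugate (m : nat) (M N : 'M[int]_m) : Prop :=
  exists2 C : 'M[int]_m, C \in unitmx & C *m M = N *m C.

Section BetaExpansion.
Context (R : realType) (b : R).

Definition tau (x : R) : R := b * x - (Num.floor (b * x))%:~R.

(* [digit x n] is the digit of index n+1.  For x >= 0 all arguments of
   [Num.truncn] are nonnegative, so that it is the integer part. *)
Definition digit (x : R) (n : nat) : nat := Num.truncn (b * iter n tau x).

(* The expansion of x >= 1 is that of b^(-n) x in [0, 1[ shifted by n places;
   finiteness does not depend on the n chosen, since dividing by b only puts
   one more 0 in front of the digits. *)
Definition Fin : set R :=
  [set x | 0 <= x /\
    exists n : nat, x / b ^+ n < 1 /\
      exists N : nat, forall k, (N <= k)%N -> digit (x / b ^+ n) k = 0%N].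

Definition Z_adjoin : set R :=
  [set (map_poly intr p).[b] | p in [set: {poly int}]].

Definition weakly_finitary : Prop :=
  forall (delta x : R), 0 < delta -> Z_adjoin x -> 0 <= x ->
    exists f, [/\ Fin f, 0 <= f < delta & Fin (x + f)].

(* [d' n] and [d n] have index n+1; [d_last] is the position (from 0) of the
   last nonzero term of d' when d' has finitely many of them. *)
Definition d' (n : nat) : nat := digit 1 n.

Definition d_last : nat :=
  xget 0%N [set k | (0 < d' k)%N /\ forall j, (0 < d' j)%N -> (j <= k)%N].

Definition d (n : nat) : nat :=
  if `[< forall N, exists2 j, (N <= j)%N & (0 < d' j)%N >] then d' n
  else let r := (n %% d_last.+1)%N in
       if r == d_last then (d' r).-1 else d' r.

Definition lex_lt (u v : nat -> nat) : Prop :=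
  exists n, (forall i, (i < n)%N -> u i = v i) /\ (u n < v n)%N.

Definition beta_compactum : set (int -> nat) :=
  [set e | (forall n, (e n <= Num.truncn b)%N) /\
           (forall n : int, lex_lt (fun i : nat => e (n + i%:Z)) d)].

End BetaExpansion.

(* Main.v *)
(* R^m splits as the expanding line R v plus a contracted hyperplane, and a code
   maps to -x v + y, where x in [0, 1] is the value of its fractional part and
   y a contracted sum over its integer part.  By Parry's criterion X_beta consists
   of the bounded sequences all of whose tails have value < 1, i.e. of two-sided
   orbits of tau.  Surjectivity follows by pulling a point back, expanding its
   unstable coordinate and pushing forward, then by compactness; codes with a tail
   of value exactly 1 are the only ones lost, and their image is null.
   For injectivity, weak finitarity gives an interval J such that two codes with
   the same image agree from the time on at which a tail value lies in J.  Codes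
   whose tails avoid J in the far past have null image: the points of [0, 1[ whose
   orbit avoids J are covered by intervals of small total length, and a box of
   unstable side s has Haar measure at most C s, because about 1 / s translates of
   it cover each point of the torus boundedly often. *)

Require Import Defs.
From HB Require Import structures.
From mathcomp Require Import all_boot all_order all_algebra.
From mathcomp Require Import ring lra zify.
From mathcomp Require Import complex.
From mathcomp Require Import all_classical all_reals all_analysis.
From mathcomp Require Import measurable_realfun.

Set Implicit Arguments.
Unset Strict Implicit.
Unset Printing Implicit Defensive.

Import Order.TTheory GRing.Theory Num.Theory.
Import numFieldNormedType.Exports.

Local Open Scope classical_set_scope.
Local Open Scope ring_scope.

(** Two uniformities carry the argument. Codes are observed at times that go to minus infinity as
    the precision improves, so what is known of a tail there reaches the image at time 1 through an
    arbitrarily high power of [M]; the constant of the box estimate must therefore not depend on the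
    unimodular matrix [A]. And the cylinders of [tau], once rescaled, must not become thin: their
    lengths are positive unstable coordinates of integer vectors with bounded stable parts, so they
    come from a finite set. Both facts, like the finiteness of the set of differences between two
    lifts of one point, rest on the finiteness of the set of integer vectors in a bounded region.
    Fundamentality places the unstable coordinates of all integer vectors in [Z[b]], up to one
    common factor removed by rescaling; this is what lets weak finitarity act on the differences.
    Contraction on the hyperplane is used in the form of summability of orbits, obtained by peeling
    off the conjugates one at a time, without diagonalisation. *)

Lemma expr_unbounded (R : realType) (b : R) (b_gt1 : 1 < b) (A : R) : exists k, A < b ^+ k.
Proof.
have b_gt0 : 0 < b by exact: lt_trans b_gt1.
have bern k : 1 + k%:R * (b - 1) <= b ^+ k.
  elim: k => [|k IH]; first by rewrite mul0r addr0 expr0.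
  rewrite exprS -natr1; have : b * (1 + k%:R * (b - 1)) <= b * b ^+ k.
    by rewrite ler_pM2l.
  have : 0 <= k%:R * (b - 1) ^+ 2 :> R by rewrite mulr_ge0 ?sqr_ge0.
  by lra.
exists (Num.truncn (A / (b - 1))).+1; apply: lt_le_trans (bern _).
have b10 : 0 < b - 1 by rewrite subr_gt0.
by have := truncnS_gt (A / (b - 1)); rewrite ltr_pdivrMr//; lra.
Qed.

(** * The greedy transformation and Parry's criterion *)

Section GreedyDynamics.
Context (R : realType) (b : R) (b_gt1 : 1 < b).
Implicit Types (x y z h eta f : R) (i j k n N : nat).

Let b_gt0 : 0 < b. Proof. exact: lt_trans b_gt1. Qed.

Lemma tau_itv x : 0 <= tau b x < 1.
Proof.
rewrite /tau subr_ge0 floor_le_tmp /=.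
by have := floorD1_gt (b * x); rewrite intrD; lra.
Qed.

Lemma tauE x : 0 <= x -> tau b x = b * x - (Num.truncn (b * x))%:R.
Proof.
move=> x0; have bx0 : 0 <= b * x by rewrite mulr_ge0// ltW.
by rewrite /tau truncn_floor bx0 natr_absz ger0_norm// floor_ge0.
Qed.

Lemma tau0 : tau b 0 = 0.
Proof. by rewrite /tau mulr0 floor0 subr0. Qed.

Lemma iter_tau0 n : iter n (tau b) 0 = 0.
Proof. by elim: n => //= n ->; exact: tau0. Qed.

Lemma iter_tau_itv n x : 0 <= x < 1 -> 0 <= iter n (tau b) x < 1.
Proof. by case: n => //= n _; exact: tau_itv. Qed.

Lemma iter_tau_ge0 n x : 0 <= x -> 0 <= iter n (tau b) x.
Proof. by case: n => //= n _; case/andP: (tau_itv (iter n (tau b) x)). Qed.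

Lemma iter_tauS n x : 0 <= x ->
  iter n.+1 (tau b) x = b * iter n (tau b) x - (digit b x n)%:R.
Proof. by move=> x0 /=; rewrite tauE ?iter_tau_ge0. Qed.

Lemma digits0_eq0 x : 0 <= x -> (forall k, digit b x k = 0%N) -> x = 0.
Proof.
move=> x0 dx; apply/eqP; rewrite eq_le x0 andbT leNgt; apply/negP => xp.
have E k : iter k (tau b) x = b ^+ k * x.
  elim: k => [|k IH]; first by rewrite mul1r.
  by rewrite iter_tauS// dx subr0 IH exprS mulrA.
have [k xk] := expr_unbounded b_gt1 x^-1.
have := E k.+1; have /andP[_] := tau_itv (iter k (tau b) x).
rewrite /= => + e; rewrite e exprS -mulrA; have : 1 < b ^+ k * x.
  by rewrite -ltr_pdivrMr// mul1r.
move: (_ * x) => X X1 X2; have : X < b * X by rewrite ltr_pMl// (lt_trans ltr01).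
by lra.
Qed.

(* [rho] is the orbit of 1 under the quasi-greedy map; keeping it positive is
   what turns the finite expansion of 1 into the periodic [d]. *)
Lemma quasi_greedy : exists rho : nat -> R,
  [/\ rho 0%N = 1, forall i, 0 < rho i <= 1 &
      forall i, rho i.+1 = b * rho i - (d b i)%:R].
Proof.
have le01 : (0 : R) <= 1 by [].
have itv1 i : 0 <= iter i (tau b) 1 <= 1.
  case: i => [|i] /=; first by rewrite lexx ler01.
  by have /andP[-> /ltW ->] := tau_itv (iter i (tau b) 1).
have gt0 i j : (i <= j)%N -> (0 < d' b j)%N -> 0 < iter i (tau b) 1.
  move=> ij dj; have /andP[i0 _] := itv1 i; rewrite lt_neqAle i0 andbT eq_sym.
  apply/eqP => i0'; move: dj; rewrite /d' /digit -(subnK ij) iterD i0'.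
  by rewrite iter_tau0 mulr0 truncn0.
rewrite /d; case: asboolP => [inf|fin].
  exists (fun i => iter i (tau b) 1); split=> // i.
    have [j ij dj] := inf i; rewrite (gt0 i j)//.
    by have /andP[_ ->] := itv1 i.
  exact: iter_tauS.
have [N dN] : exists N, forall j, (N <= j)%N -> d' b j = 0%N.
  apply: contrapT => H; apply: fin => N; apply: contrapT => H'; apply: H.
  exists N => j Nj; apply/eqP; rewrite -leqn0 leqNgt; apply/negP => dj.
  by apply: H'; exists j.
have d0 : (0 < d' b 0)%N.
  by rewrite /d' /digit /= mulr1 truncn_gt0 ltW.
have exk : exists k, (0 < d' b k)%N /\ forall j, (0 < d' b j)%N -> (j <= k)%N.
  have ex0 : exists j, (0 < d' b j)%N by exists 0%N.
  have ub j : (0 < d' b j)%N -> (j <= N)%N.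
    by move=> dj; rewrite leqNgt; apply/negP => /ltnW /dN e; rewrite e in dj.
  by case: (ex_maxnP ex0 ub) => k dk kmax; exists k; split.
have [dK Kmax] := xgetPex 0%N exk; rewrite -/(d_last b) in dK Kmax.
set K := d_last b in dK Kmax *.
have K0 : iter K.+1 (tau b) 1 = 0.
  apply: digits0_eq0 => [|k]; first exact: iter_tau_ge0.
  apply/eqP; rewrite -leqn0 leqNgt; apply/negP => H.
  suff /Kmax : (0 < d' b (k + K.+1))%N by rewrite addnS ltnNge leq_addl.
  by rewrite /d' /digit iterD.
exists (fun i => iter (i %% K.+1) (tau b) 1); split => [|i|i].
- by rewrite mod0n.
- rewrite (gt0 _ K) ?dK//; last by rewrite -ltnS ltn_pmod.
  by have /andP[_ ->] := itv1 (i %% K.+1)%N.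
- have -> : (i.+1 %% K.+1 =
      if (i %% K.+1 == K)%N then 0 else (i %% K.+1).+1)%N.
    rewrite -addn1 -modnDml addn1; case: eqP => [->|ne]; first by rewrite modnn.
    by rewrite modn_small// ltnS ltn_neqAle -ltnS ltn_pmod// andbT; apply/eqP.
  case: eqP => [->|_]; last by rewrite iter_tauS.
  have := iter_tauS K le01; rewrite K0 -/(d' b K) => e.
  by rewrite -subn1 natrB// [iter 0 _ _]/=; lra.
Qed.

(** While the digits agree, the gap [rho n - x n] is [b ^+ n] times the initial one. It never
    exceeds 1, so the digits must differ somewhere; at the first difference, a larger digit of [e]
    would push the next gap above 1. *)
Lemma greedy_lex_lt (x : nat -> R) (e : nat -> nat) :
  (forall i, 0 <= x i < 1) -> (forall i, x i.+1 = b * x i - (e i)%:R) ->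
  lex_lt e (d b).
Proof.
move=> x01 xS; have [rho [rho0 rhoP rhoS]] := quasi_greedy.
have diff n : (forall i, (i < n)%N -> e i = d b i) ->
    rho n - x n = b ^+ n * (1 - x 0%N).
  elim: n => [|n IH] H; first by rewrite rho0 mul1r.
  rewrite rhoS xS H// exprS -mulrA -IH; last by move=> i /ltnW; exact: H.
  by ring.
have dpos : 0 < 1 - x 0%N by rewrite subr_gt0; case/andP: (x01 0%N).
have exn : exists n, e n != d b n.
  apply: contrapT => H; have {}H i : e i = d b i.
    by apply/eqP/negPn/negP => ?; apply: H; exists i.
  have [k] := expr_unbounded b_gt1 (1 - x 0%N)^-1.
  rewrite -[ltLHS]mul1r ltr_pdivrMr// -diff//.
  by have := rhoP k; have := x01 k; lra.
case: (ex_minnP exn) => n en nmin; exists n.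
have eq_lt i : (i < n)%N -> e i = d b i.
  by move=> i_n; apply/eqP/negPn/negP => /nmin; rewrite leqNgt i_n.
split=> //; rewrite ltn_neqAle en /= leqNgt; apply/negP => dn.
have Dpos : 0 < b * (rho n - x n) by rewrite diff// !mulr_gt0 ?exprn_gt0.
have := rhoP n.+1; have := x01 n.+1; rewrite rhoS xS.
have : (d b n)%:R + 1 <= (e n)%:R :> R by rewrite natr1 ler_nat.
by lra.
Qed.

(** If a value reaches 1, follow the digits to the first place where they drop below [d]: just after
    it the excess over 1 is more than [b] times the old one. Repetition contradicts the bound
    [V]. *)
Lemma lex_lt_lt1 (v : nat -> R) (e : nat -> nat) (V : R) :
  (forall i, 0 <= v i <= V) -> (forall i, v i.+1 = b * v i - (e i)%:R) ->
  (forall n, lex_lt (fun i => e (n + i)%N) (d b)) -> forall n, v n < 1.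
Proof.
move=> vV vS lexv; have [rho [rho0 rhoP rhoS]] := quasi_greedy.
have step n : 1 <= v n -> exists n', b * (v n - 1) < v n' - 1.
  move=> vn; have [i [ei ltei]] := lexv n; exists (n + i).+1.
  have diff j : (j <= i)%N -> rho j - v (n + j)%N = b ^+ j * (1 - v n).
    elim: j => [_|j IH ji]; first by rewrite rho0 addn0 mul1r.
    by rewrite rhoS addnS vS ei// exprS -mulrA -IH ?(ltnW ji)//; ring.
  have /= := congr1 ( *%R b) (diff i (leqnn i)); have := rhoP i.+1; rewrite rhoS vS.
  have : (e (n + i)%N)%:R + 1 <= (d b i)%:R :> R by rewrite natr1 ler_nat.
  have : b * (v n - 1) <= b * (b ^+ i * (v n - 1)).
    by rewrite ler_pM2l// ler_peMl ?subr_ge0// exprn_ege1// ltW.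
  by lra.
move=> n; rewrite ltNge; apply/negP => vn.
(* A value of exactly 1 has excess 0; one step makes the excess positive, so that it can grow
   geometrically. *)
have [n1 n1P] := step _ vn.
have v1 : 1 < v n1.
  by rewrite -subr_gt0; apply: le_lt_trans n1P; rewrite mulr_ge0 ?subr_ge0 ?(ltW b_gt0).
have grow k : exists m, b ^+ k * (v n1 - 1) <= v m - 1.
  elim: k => [|k [m mP]]; first by exists n1; rewrite mul1r.
  have [|m' m'P] := step m.
    by rewrite -subr_ge0; apply: le_trans mP; rewrite mulr_ge0 ?exprn_ge0 ?subr_ge0 ?(ltW b_gt0) ?(ltW v1).
  exists m'; apply: le_trans (ltW m'P); rewrite exprS -mulrA ler_pM2l//.
have [k] := expr_unbounded b_gt1 (V / (v n1 - 1)).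
rewrite ltr_pdivrMr ?subr_gt0// => Vk; have [m mP] := grow k.
by have := vV m; lra.
Qed.

(** The floor is constant on a short interval to the right of any point. This is why the
    perturbations used below are nonnegative. *)
Lemma tau_right_linear y : 0 <= y < 1 ->
  exists2 eta, 0 < eta & forall h, 0 <= h < eta ->
    y + h < 1 /\ tau b (y + h) = tau b y + b * h.
Proof.
move=> /andP[y0 y1]; have /andP[t0 t1] := tau_itv y.
exists (Num.min (1 - y) ((1 - tau b y) / b)).
  by rewrite lt_min subr_gt0 y1 divr_gt0// subr_gt0.
move=> h /andP[h0]; rewrite lt_min ltr_pdivlMr// => /andP[h1 h2].
split; first lra.
rewrite /tau mulrDr (_ : Num.floor (b * y + b * h) = Num.floor (b * y)); first by ring.
apply: floor_def; move: t0 t1 h2; rewrite /tau intrD mulr1z => t0 t1 h2.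
have : 0 <= b * h by rewrite mulr_ge0// ltW.
by lra.
Qed.

Lemma iter_tau_right_linear N y : 0 <= y < 1 ->
  exists2 eta, 0 < eta & forall h, 0 <= h < eta ->
    y + h < 1 /\ iter N (tau b) (y + h) = iter N (tau b) y + b ^+ N * h.
Proof.
move=> y01; elim: N => [|N [eta eta0 H]].
  exists (1 - y); first by lra.
  by move=> h h0 /=; rewrite mul1r; split=> //; lra.
have [eta' eta'0 H'] := tau_right_linear (iter_tau_itv N y01).
have bN : 0 < b ^+ N by rewrite exprn_gt0.
exists (Num.min eta (eta' / b ^+ N)).
  by rewrite lt_min eta0 divr_gt0.
move=> h /andP[h0]; rewrite lt_min ltr_pdivlMr// => /andP[h1 h2].
have [|yh1 yhN] := H h; first by rewrite h0 h1.
split=> //.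
rewrite /= {}yhN; have [|_ ->] := H' (b ^+ N * h).
  by rewrite mulr_ge0 ?(ltW bN)//= mulrC.
by rewrite exprS mulrA.
Qed.

Lemma iter_tau_div n x : 0 <= x < 1 -> iter n (tau b) (x / b ^+ n) = x.
Proof.
move=> /andP[x0 x1]; have bn k : 0 < b ^+ k by rewrite exprn_gt0.
elim: n => [|n IH]; first by rewrite expr0 divr1.
have z0 : 0 <= x / b ^+ n.+1 by rewrite divr_ge0// ltW.
rewrite iterSr tauE//.
have -> : b * (x / b ^+ n.+1) = x / b ^+ n.
  by rewrite exprS; field; rewrite !gt_eqF.
rewrite (@truncn_def _ _ 0) ?subr0// divr_ge0 ?(ltW (bn _))//=.
by rewrite ltr_pdivrMr// mul1r; apply: lt_le_trans x1 _; rewrite exprn_ege1// ltW.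
Qed.

(** The dynamical form of a finite expansion for points of [[0, 1[]; unlike [Fin], it involves no
    choice of a power of [b]. *)
Definition finite_orbit x := exists N, iter N (tau b) x = 0.

Lemma finite_orbit_ge x N n : (N <= n)%N -> iter N (tau b) x = 0 ->
  iter n (tau b) x = 0.
Proof. by move=> /subnK <- xN; rewrite iterD xN iter_tau0. Qed.

Lemma Fin_finite_orbit x : x < 1 -> Fin b x -> finite_orbit x.
Proof.
move=> x1 [x0 [n [_ [N dN]]]]; exists N.
have z0 : 0 <= x / b ^+ n by rewrite divr_ge0// exprn_ge0// ltW.
have zN : iter N (tau b) (x / b ^+ n) = 0.
  apply: digits0_eq0 => [|k]; first exact: iter_tau_ge0.
  by have := dN (k + N)%N (leq_addl _ _); rewrite /digit iterD.
by rewrite -(iter_tau_div n (x := x)) ?x0// -iterD addnC iterD zN iter_tau0.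
Qed.

(** For [h] so small that both [y] and 0 are moved affinely during [N] steps, the points [y + h] and
    [h] are both sent to [b ^+ N * h]. *)
Lemma finite_orbit_add y : 0 <= y < 1 -> finite_orbit y ->
  exists2 eta, 0 < eta & forall h, 0 <= h < eta -> finite_orbit h ->
    y + h < 1 /\ finite_orbit (y + h).
Proof.
move=> y01 [N yN]; have [eta eta0 H] := iter_tau_right_linear N y01.
have [|eta' eta'0 H'] := @iter_tau_right_linear N 0; first by rewrite lexx ltr01.
exists (Num.min eta eta'); first by rewrite lt_min eta0.
move=> h /andP[h0]; rewrite lt_min => /andP[h1 h2] [K hK].
have [|yh1 yhN] := H h; first by rewrite h0.
have [|_ hN] := H' h; first by rewrite h0.
split=> //; exists (K + N)%N.
rewrite iterD yhN yN -(iter_tau0 N) -hN add0r -iterD.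
by rewrite iter_tau0; apply: finite_orbit_ge hK; rewrite leq_addr.
Qed.

Lemma Z_adjoin_int (i : int) : Z_adjoin b i%:~R.
Proof. by exists i%:P => //; rewrite map_polyC hornerC. Qed.

Lemma Z_adjoinD x y : Z_adjoin b x -> Z_adjoin b y -> Z_adjoin b (x + y).
Proof. by move=> [p _ <-] [q _ <-]; exists (p + q) => //; rewrite rmorphD hornerD. Qed.

Lemma Z_adjoinN x : Z_adjoin b x -> Z_adjoin b (- x).
Proof. by move=> [p _ <-]; exists (- p) => //; rewrite rmorphN hornerN. Qed.

Lemma Z_adjoinM x y : Z_adjoin b x -> Z_adjoin b y -> Z_adjoin b (x * y).
Proof. by move=> [p _ <-] [q _ <-]; exists (p * q) => //; rewrite rmorphM hornerM. Qed.

Lemma seq_common_radius (T : eqType) (s : seq T) (P : T -> R -> Prop) :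
  (forall y : T, y \in s -> exists2 eta, 0 < eta & forall h, 0 <= h < eta -> P y h) ->
  exists2 eta, 0 < eta & forall h, 0 <= h < eta -> forall y : T, y \in s -> P y h.
Proof.
elim: s => [|y s IH] H; first by exists 1.
have [e1 e10 H1] := H y (mem_head _ _).
have [|e2 e20 H2] := IH; first by move=> z zs; apply: H; rewrite inE zs orbT.
exists (Num.min e1 e2); first by rewrite lt_min e10.
move=> h /andP[h0]; rewrite lt_min => /andP[h1 h2] z; rewrite inE.
by case/orP => [/eqP ->|]; [apply: H1; rewrite h0|apply: H2; rewrite h0].
Qed.

Lemma seq_common_rank (T : eqType) (s : seq T) (P : T -> nat -> Prop) :
  (forall y : T, y \in s -> exists N, forall n, (N <= n)%N -> P y n) ->
  exists N, forall n, (N <= n)%N -> forall y : T, y \in s -> P y n.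
Proof.
elim: s => [|y s IH] H; first by exists 0%N.
have [N1 H1] := H y (mem_head _ _).
have [|N2 H2] := IH; first by move=> z zs; apply: H; rewrite inE zs orbT.
exists (maxn N1 N2) => n; rewrite geq_max => /andP[n1 n2] z; rewrite inE.
by case/orP => [/eqP ->|]; [exact: H1|exact: H2].
Qed.

(** * Synchronisation of orbits from weak finitarity *)

Section Synchronisation.
Context (Zinv : forall x, Z_adjoin b x -> Z_adjoin b (x / b)).
Context (WF : weakly_finitary b).

Lemma finite_orbit_Z_adjoin x : 0 <= x -> finite_orbit x -> Z_adjoin b x.
Proof.
move=> x0 [N]; elim: N x x0 => [x _ /= ->|N IH x x0]; first exact: (Z_adjoin_int 0).
have /andP[t0 _] := tau_itv x; rewrite iterSr => /(IH _ t0) tx.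
have -> : x = (tau b x + (Num.truncn (b * x))%:Z%:~R) / b.
  by rewrite tauE// -pmulrn; field; rewrite gt_eqF.
by apply/Zinv/Z_adjoinD => //; exact: Z_adjoin_int.
Qed.

(** Weak finitarity treats one point at a time. A correction [f1] for the tail of the list is
    followed by a second one, [f2], adapted to [y + f1] and so small that, by [finite_orbit_add],
    the orbits already made finite stay finite. *)
Lemma common_finite_orbit (ys : seq R) :
  (forall y, y \in ys -> Z_adjoin b y /\ 0 <= y < 1) ->
  forall eta, 0 < eta -> exists f, [/\ 0 <= f < eta, finite_orbit f &
    forall y, y \in ys -> y + f < 1 /\ finite_orbit (y + f)].
Proof.
elim: ys => [_ eta eta0|y ys IH ysP eta eta0].
  by exists 0; rewrite lexx eta0; split=> //; exists 0%N.
have [yZ /andP[y0 y1]] := ysP y (mem_head _ _).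
have ysP' z : z \in ys -> Z_adjoin b z /\ 0 <= z < 1.
  by move=> zs; apply: ysP; rewrite inE zs orbT.
have [|f1 [/andP[f10]]] := IH ysP' (Num.min eta (1 - y)).
  by rewrite lt_min eta0 subr_gt0.
rewrite lt_min => /andP[f1e f1y] f1fin f1ys.
(* [f1] itself is in the list: the new correction [f1 + f2] must again have a finite orbit, since
   the next round uses this to place its point in [Z[b]]. *)
have [|r r0 rP] := @seq_common_radius _ (f1 :: [seq z + f1 | z <- ys])
    (fun z h => finite_orbit h -> z + h < 1 /\ finite_orbit (z + h)).
  move=> z; rewrite inE => /orP[/eqP ->|/mapP[z' z's ->]].
    by apply: finite_orbit_add => //; rewrite f10/=; lra.
  have [z1 zf] := f1ys _ z's; apply: finite_orbit_add => //.
  by rewrite z1 andbT addr_ge0//; case: (ysP' _ z's) => _ /andP[].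
have := @WF (Num.min r (Num.min (eta - f1) (1 - y - f1))) (y + f1).
case=> [||| f2 [f2fin]].
- by rewrite !lt_min r0 !subr_gt0 f1e/=; lra.
- by apply: Z_adjoinD => //; exact: finite_orbit_Z_adjoin.
- by rewrite addr_ge0.
rewrite !lt_min => /and4P[f20 f2r f2e f2y] yf.
have f2o : finite_orbit f2 by apply: Fin_finite_orbit => //; lra.
have H := rP f2; rewrite f20 f2r in H; have {}H z zs := H isT z zs f2o.
exists (f1 + f2); split; first lra.
  by have [] := H f1 (mem_head _ _).
move=> z; rewrite inE addrA => /orP[/eqP ->|zs].
  have yf1 : y + f1 + f2 < 1 by lra.
  by split=> //; exact: Fin_finite_orbit.
by apply: H; rewrite inE (map_f (fun z => z + f1) zs) orbT.
Qed.

(** [ds] stands for the possible differences between the tail values of two codes with the same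
    image. Take [p = c + f], where [c] is at least every [- z], and [f] makes the orbits of [p] and
    of the relevant [p + z] finite. After a common number [L] of steps all of them are at 0, so
    [p + h] and [p + h + z] are both sent to [b ^+ L * h] for small [h >= 0]. *)
Lemma synchronising_interval (ds : seq R) :
  (forall z, z \in ds -> Z_adjoin b z /\ `|z| < 1) ->
  exists p L eta, [/\ 0 <= p < 1, 0 < eta, iter L (tau b) p = 0 &
    forall z h, z \in ds -> 0 <= h < eta -> 0 <= p + h + z < 1 ->
      iter L (tau b) (p + h + z) = iter L (tau b) (p + h)].
Proof.
move=> dsP.
have [c [cZ c0 c1 cP]] : exists c, [/\ Z_adjoin b c, 0 <= c, c < 1 &
    forall z, z \in ds -> - z <= c].
  elim: ds dsP => [_|z ds IH dsP].
    by exists 0; split=> //; exact: (Z_adjoin_int 0).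
  have [|c [cZ c0 c1 cP]] := IH.
    by move=> z' z'ds; apply: dsP; rewrite inE z'ds orbT.
  have [zZ] := dsP z (mem_head _ _); rewrite ltr_norml => /andP[z1 z2].
  have [cz|zc] := leP (- z) c.
    by exists c; split=> // z'; rewrite inE => /orP[/eqP ->|/cP].
  exists (- z); split; [exact: Z_adjoinN|exact: le_trans (ltW zc)|lra|].
  move=> z'; rewrite inE => /orP[/eqP ->//|/cP] z'c.
  exact: le_trans (ltW zc).
(* The differences left out satisfy [p + h + z >= c + z >= 1], which the conclusion excludes. *)
pose ys := c :: [seq c + z | z <- ds & c + z < 1].
have ysP y : y \in ys -> Z_adjoin b y /\ 0 <= y < 1.
  rewrite inE => /orP[/eqP ->|/mapP[z]]; first by rewrite c0.
  rewrite mem_filter => /andP[cz1 zds ->]; have [zZ _] := dsP _ zds.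
  by split; [exact: Z_adjoinD|have := cP _ zds; lra].
have [//|f [/andP[f0 f1] _ fP]] := common_finite_orbit ysP (_ : 0 < 1).
have [|L LP] := @seq_common_rank _ ys (fun y n => iter n (tau b) (y + f) = 0).
  move=> y /fP[_ [N yN]]; exists N => n; by move/finite_orbit_ge; apply.
have {}LP := LP L (leqnn _).
have [|eta eta0 etaP] := @seq_common_radius _ ys
    (fun y h => iter L (tau b) (y + f + h) = b ^+ L * h).
  move=> y ys_y; have [_ /andP[y0 _]] := ysP _ ys_y; have [yf1 _] := fP _ ys_y.
  have [|e e0 eP] := @iter_tau_right_linear L (y + f); first by rewrite addr_ge0.
  by exists e => // h /eP[_ ->]; rewrite LP// add0r.
exists (c + f), L, eta; split=> //; last 1 first.
- move=> z h zds hP /andP[pz0 pz1]; have [h0 _] := andP hP.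
  rewrite (etaP h hP c) ?mem_head//.
  have -> : c + f + h + z = c + z + f + h by ring.
  apply: (etaP h hP); rewrite inE; apply/orP; right; apply/map_f.
  by rewrite mem_filter zds andbT; lra.
- by rewrite addr_ge0//; case: (fP c (mem_head _ _)).
- by apply: LP; rewrite mem_head.
Qed.

End Synchronisation.

(** * Cylinders, and the size of the set of points whose orbits avoid an interval *)

Lemma sum_unit_intervals (X : R) n : 0 <= X ->
  \sum_(j <- iota 0 n | j%:R < X) Num.min 1 (X - j%:R) = Num.min n%:R X.
Proof.
move=> X0; rewrite -{1}[n]subn0 -/(index_iota 0 n); elim: n => [|n IH]; first by rewrite big_geq// min_l.
rewrite big_mkcond big_nat_recr//= -big_mkcond /= IH -natr1.
case: ltP => nX.
  case: (leP 1 (X - n%:R)) => H.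
    by rewrite min_l//; lra.
  by rewrite min_r//; lra.
by rewrite addr0 min_r//; lra.
Qed.

(* The intervals [[u.1, u.1 + u.2 / b ^+ j[] are the level-[j] cylinders of
   [[0, c[]: on each of them [tau^j] is affine, with image [[0, u.2[]. *)
Fixpoint cylinders (j : nat) (c : R) : seq (R * R) :=
  if j is j'.+1 then
    flatten [seq [seq ((i%:R + u.1) / b, u.2) |
                    u <- cylinders j' (Num.min 1 (b * c - i%:R))]
               | i <- [seq i <- iota 0 (Num.truncn b).+1 | i%:R < b * c]]
  else [:: (0, c)].

Lemma cylindersS j c : cylinders j.+1 c =
  flatten [seq [seq ((i%:R + u.1) / b, u.2) |
                  u <- cylinders j (Num.min 1 (b * c - i%:R))]
             | i <- [seq i <- iota 0 (Num.truncn b).+1 | i%:R < b * c]].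
Proof. by []. Qed.

Section Cover.
(** [CC] stands for the lengths that rescaled cylinders can take. The uniform lower bound [kappa] is
    where the Pisot property will enter. *)
Context (CC : set R) (kappa : R).
Context (kappa_gt0 : 0 < kappa) (CC_itv : forall c, CC c -> kappa <= c <= 1).
Context (CC_step : forall c i, CC c -> i%:R < b * c ->
  CC (Num.min 1 (b * c - i%:R))).

Lemma CC_gt0 c : CC c -> 0 < c.
Proof. by move=> /CC_itv/andP[+ _]; exact: lt_le_trans. Qed.

Lemma mem_cylindersS j c u : u \in cylinders j.+1 c -> exists i w,
  [/\ i%:R < b * c, w \in cylinders j (Num.min 1 (b * c - i%:R)) &
      u = ((i%:R + w.1) / b, w.2)].
Proof.
move=> /flattenP[t /mapP[k]]; rewrite mem_filter => /andP[ic _] ->.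
by case/mapP => w wP ->; exists k, w.
Qed.

Lemma cylinders_CC j c u : CC c -> u \in cylinders j c -> CC u.2 /\ 0 <= u.1.
Proof.
elim: j c u => [|j IH] c u cC; first by rewrite inE => /eqP ->.
move=> /mem_cylindersS[i [w [ic wc ->]]] /=.
have [w2 w1] := IH _ _ (CC_step cC ic) wc.
by split=> //; rewrite divr_ge0 ?addr_ge0// ltW.
Qed.

Lemma cylinders_sum j c : CC c ->
  \sum_(u <- cylinders j c) u.2 = c * b ^+ j.
Proof.
elim: j c => [|j IH] c cC; first by rewrite big_seq1 mulr1.
rewrite cylindersS big_flatten big_map big_filter.
under eq_bigr => i ic do rewrite big_map /= (IH _ (CC_step cC ic)).
rewrite -mulr_suml sum_unit_intervals ?mulr_ge0 ?(ltW b_gt0) ?(ltW (CC_gt0 cC))//.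
rewrite min_r; first by rewrite exprS mulrA (mulrC c).
apply: (@le_trans _ _ b); first by rewrite ler_piMr ?(ltW b_gt0)//; case/andP: (CC_itv cC).
by rewrite ltW// truncnS_gt.
Qed.

Lemma cylinders_cover j c x : CC c -> 0 <= x < c ->
  exists2 u, u \in cylinders j c & u.1 <= x < u.1 + u.2 / b ^+ j.
Proof.
elim: j c x => [|j IH] c x cC xc.
  by exists (0, c); rewrite ?mem_head//= add0r divr1.
have /andP[x0 x1] := xc; have bx0 : 0 <= b * x by rewrite mulr_ge0// ltW.
have /andP[i1 i2] := truncn_itv bx0; set i := Num.truncn (b * x) in i1 i2.
have bxc : b * x < b * c by rewrite ltr_pM2l.
have ic : i%:R < b * c by apply: le_lt_trans bxc.
have [|w wc] := IH (Num.min 1 (b * c - i%:R)) (b * x - i%:R) (CC_step cC ic).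
  by rewrite subr_ge0 i1 lt_min ltrD2r bxc andbT; move: i2; rewrite -natr1; lra.
move=> wx; exists ((i%:R + w.1) / b, w.2).
  apply/flattenP; exists [seq ((i%:R + u.1) / b, u.2) |
                    u <- cylinders j (Num.min 1 (b * c - i%:R))].
    apply/mapP; exists i => //; rewrite mem_filter ic mem_iota add0n ltnS/=.
    apply: le_truncn; rewrite ler_piMr ?(ltW b_gt0)//.
    by case/andP: (CC_itv cC) => _ c1; exact: le_trans (ltW x1) c1.
  by apply/mapP; exists w.
have bj : 0 < b ^+ j by rewrite exprn_gt0.
rewrite /= ler_pdivrMr//.
have -> : (i%:R + w.1) / b + w.2 / b ^+ j.+1 = (i%:R + w.1 + w.2 / b ^+ j) / b.
  by rewrite exprS; field; rewrite !gt_eqF.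
by rewrite ltr_pdivlMr//; move: wx => /andP[wx1 wx2]; lra.
Qed.

Lemma cylinders_le j c u : CC c -> u \in cylinders j c ->
  u.1 + u.2 / b ^+ j <= c.
Proof.
elim: j c u => [|j IH] c u cC; first by rewrite inE => /eqP -> /=; rewrite divr1 add0r.
move=> /mem_cylindersS[i [w [ic wc ->]]] /=.
have := IH _ _ (CC_step cC ic) wc; rewrite le_min => /andP[_ H].
have bj : 0 < b ^+ j by rewrite exprn_gt0.
have -> : (i%:R + w.1) / b + w.2 / b ^+ j.+1 = (i%:R + w.1 + w.2 / b ^+ j) / b.
  by rewrite exprS; field; rewrite !gt_eqF.
by rewrite ler_pdivrMr//; lra.
Qed.

Lemma cylinders_affine j c u x : CC c -> u \in cylinders j c ->
  u.1 <= x < u.1 + u.2 / b ^+ j -> iter j (tau b) x = b ^+ j * (x - u.1).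
Proof.
elim: j c u x => [|j IH] c u x cC; first by rewrite inE => /eqP -> _ /=; lra.
move=> /mem_cylindersS[i [w [ic wc ->]]] /=.
have iC := CC_step cC ic.
have [w2 w1] := cylinders_CC iC wc.
have bj : 0 < b ^+ j by rewrite exprn_gt0.
have -> : (i%:R + w.1) / b + w.2 / b ^+ j.+1 = (i%:R + w.1 + w.2 / b ^+ j) / b.
  by rewrite exprS; field; rewrite !gt_eqF.
rewrite ler_pdivrMr// ltr_pdivlMr// => /andP[wx1 wx2].
have := IH _ _ (b * x - i%:R) iC wc.
have wx : w.1 <= b * x - i%:R < w.1 + w.2 / b ^+ j by lra.
move=> /(_ wx) E; rewrite -iterS iterSr.
have x0 : 0 <= x by rewrite -(pmulr_rge0 _ b_gt0); have : 0 <= i%:R :> R by []; lra.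
have -> : tau b x = b * x - i%:R.
  rewrite tauE// (@truncn_def _ _ i)//; apply/andP; split; first lra.
  suff : b * x - i%:R < 1 by rewrite -natr1; lra.
  by have := cylinders_le iC wc; rewrite le_min => /andP[]; lra.
rewrite E exprSr; field; by rewrite gt_eqF.
Qed.

Context (CC1 : CC 1) (p eta : R) (L : nat).
Context (p_itv : 0 <= p < 1) (eta_gt0 : 0 < eta).
Context (tau_p : iter L (tau b) p = 0).
Let J x := p <= x < p + eta.

(* Every [[0, c[] contains a shrunk copy of the interval [J], located at
   [p / b ^+ s0]; the cylinder starting there can be discarded. *)
Lemma avoid_step : exists K theta, [/\ 0 < theta < 1 &
  forall c, CC c -> exists s : seq (R * R),
    [/\ \sum_(u <- s) u.2 <= theta * c * b ^+ K,
        forall u, u \in s -> CC u.2 &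
        forall x, 0 <= x < c ->
          (forall j, (j <= K)%N -> ~~ J (iter j (tau b) x)) ->
          exists u, [/\ u \in s, u.1 <= x < u.1 + u.2 / b ^+ K &
            iter K (tau b) x = b ^+ K * (x - u.1)]]].
Proof.
have /andP[p0 p1] := p_itv.
(* With [b ^+ s0 > 1 / kappa], the point [p / b ^+ s0] lies in [[0, c[] for every [c] in [CC]. *)
have [s0 s0P] := expr_unbounded b_gt1 kappa^-1.
pose r := Num.min eta (1 - p).
have r0 : 0 < r by rewrite lt_min eta_gt0 subr_gt0.
(* Since [j1 >= L], the point [p / b ^+ s0] is at 0 at time [s0 + j1], hence is the left endpoint of
   its cylinder; the second bound makes [tau] iterated [s0] times send that cylinder into [[p, p +
   r[]. *)
have [j1 j1P] : exists j1, (L <= j1)%N /\ r^-1 < b ^+ j1.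
  have [k kP] := expr_unbounded b_gt1 r^-1; exists (L + k)%N.
  rewrite leq_addr; split=> //; apply: lt_le_trans kP _.
  by rewrite ler_weXn2l ?leq_addl// ltW.
have bn k : 0 < b ^+ k by rewrite exprn_gt0.
set K := (s0 + j1)%N; exists K.
(* Discarding one cylinder removes at least [kappa] from the total. Half of this gain is given up so
   that [theta > 0] follows from [kappa <= 1]. *)
pose theta := 1 - kappa / b ^+ K / 2.
have kK : kappa / b ^+ K <= kappa.
  by rewrite ler_pdivrMr// ler_peMr ?(ltW kappa_gt0)// exprn_ege1// ltW.
exists theta; split.
  have k1 : 0 < kappa / b ^+ K by rewrite divr_gt0.
  by have /andP[k2 _] := CC_itv CC1; rewrite /theta; lra.
move=> c cC; have /andP[kc c1] := CC_itv cC.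
have a0c : 0 <= p / b ^+ s0 < c.
  rewrite divr_ge0 ?(ltW (bn _))//= ltr_pdivrMr//; apply: lt_le_trans p1 _.
  apply: (@le_trans _ _ (kappa * b ^+ s0)); last by rewrite ler_pM2r.
  by rewrite mulrC -ler_pdivrMr// mul1r ltW.
have [u0 u0P /andP[u01 u02]] := cylinders_cover K cC a0c.
have u0E : u0.1 = p / b ^+ s0.
  have : iter K (tau b) (p / b ^+ s0) = 0.
    by rewrite /K addnC iterD iter_tau_div//; apply: finite_orbit_ge tau_p; case: j1P.
  rewrite (cylinders_affine cC u0P) ?u01// => /eqP.
  by rewrite mulf_eq0 gt_eqF//= subr_eq0 => /eqP.
have [u0C _] := cylinders_CC cC u0P; have /andP[ku0 u021] := CC_itv u0C.
exists (rem u0 (cylinders K c)); split.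
- have := cylinders_sum K cC; rewrite (big_rem _ u0P)/= => E.
  have : theta * c * b ^+ K = c * b ^+ K - kappa * c / 2.
    by rewrite /theta; field; rewrite gt_eqF.
  move=> ->; have : kappa * c <= kappa by rewrite ler_piMr ?(ltW kappa_gt0).
  by have := mulr_gt0 kappa_gt0 (CC_gt0 cC); lra.
- by move=> u /mem_rem /(cylinders_CC cC)[].
- move=> x xc avoid; have [u uP ux] := cylinders_cover K cC xc.
  exists u; split=> //; last exact: (cylinders_affine cC uP).
  apply: rem_mem => //; apply/eqP => uu0; subst u.
  have := avoid s0 (leq_addr _ _); case: j1P => _ j1P.
  have -> : x = (p + b ^+ s0 * (x - u0.1)) / b ^+ s0.
    by rewrite u0E; field; rewrite gt_eqF.
  set h := b ^+ s0 * _.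
  have h0 : 0 <= h by rewrite mulr_ge0 ?(ltW (bn _)) ?subr_ge0//; case/andP: ux.
  have hr : h < r.
    rewrite /h; apply: (@lt_le_trans _ _ (b ^+ s0 * (u0.2 / b ^+ K))).
      by rewrite ltr_pM2l//; move: ux => /andP[]; lra.
    rewrite /K exprD (_ : _ * _ = u0.2 / b ^+ j1); last by field; rewrite !gt_eqF.
    rewrite ler_pdivrMr//; apply: le_trans u021 _.
    by rewrite mulrC -ler_pdivrMr// mul1r ltW.
  move: hr; rewrite lt_min => /andP[hr hp].
  rewrite iter_tau_div; last by rewrite addr_ge0//=; lra.
  by rewrite /J lerDl h0 ltrD2l hr.
Qed.

(** After [K] steps each surviving cylinder has become an interval [[0, u.2[] with [u.2] in [CC], to
    which [avoid_step] applies again. Every round gains the factor [theta], uniformly in [c]. *)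
Lemma avoid_iter : exists K theta, [/\ 0 < theta < 1 &
  forall q c, CC c -> exists s : seq (R * R),
    [/\ \sum_(u <- s) u.2 <= theta ^+ q * c * b ^+ (q * K),
        forall u, u \in s -> CC u.2 &
        forall x, 0 <= x < c ->
          (forall j, (j <= q * K)%N -> ~~ J (iter j (tau b) x)) ->
          exists2 u, u \in s & u.1 <= x < u.1 + u.2 / b ^+ (q * K)]].
Proof.
have [K [theta [theta01 step]]] := avoid_step; exists K, theta; split=> //.
have /andP[theta0 _] := theta01.
have bn k : 0 < b ^+ k by rewrite exprn_gt0.
elim=> [|q IH] c cC.
  exists [:: (0, c)]; rewrite big_seq1 !mul1r mul0n mulr1/=; split=> //.
    by move=> u; rewrite inE => /eqP ->.
  by move=> x xc _; exists (0, c); rewrite ?mem_head//= add0r divr1.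
have [s [ssum sC scov]] := step c cC.
have /choice[t tP] : forall c', exists t : seq (R * R), CC c' ->
    [/\ \sum_(u <- t) u.2 <= theta ^+ q * c' * b ^+ (q * K),
        forall u, u \in t -> CC u.2 &
        forall x, 0 <= x < c' ->
          (forall j, (j <= q * K)%N -> ~~ J (iter j (tau b) x)) ->
          exists2 u, u \in t & u.1 <= x < u.1 + u.2 / b ^+ (q * K)].
  move=> c'; have [c'C|nC] := pselect (CC c'); last by exists [::].
  by have [t tP] := IH c' c'C; exists t.
exists (flatten [seq [seq (u.1 + w.1 / b ^+ K, w.2) | w <- t u.2] | u <- s]).
split.
- rewrite big_flatten big_map.
  apply: (@le_trans _ _ (\sum_(u <- s) theta ^+ q * u.2 * b ^+ (q * K))).
    rewrite !big_seq; apply: ler_sum => u us; rewrite big_map /=.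
    by have [] := tP u.2 (sC u us).
  rewrite -mulr_suml -mulr_sumr mulSn exprD exprSr.
  have := ler_wpM2r (ltW (bn (q * K)%N)) (ler_wpM2l (ltW (exprn_gt0 q theta0)) ssum).
  by move=> /le_trans; apply; rewrite !mulrA.
- move=> w /flattenP[r /mapP[u us ->] /mapP[w' w't ->]] /=.
  by have [_ + _] := tP u.2 (sC u us); apply.
- move=> x xc avoid; have [|u [us /andP[ux1 ux2] xK]] := scov x xc.
    by move=> j jK; apply: avoid; rewrite mulSn (leq_trans jK)// leq_addr.
  have [_ _ cov] := tP u.2 (sC u us).
  have [||w wt /andP[wx1 wx2]] := cov (iter K (tau b) x).
  + rewrite xK mulr_ge0 ?subr_ge0 ?(ltW (bn _))//= mulrC -ltr_pdivlMr//.
    by rewrite ltrBlDl.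
  + by move=> j jK; rewrite -iterD; apply: avoid; rewrite mulSn addnC leq_add2l.
  exists (u.1 + w.1 / b ^+ K, w.2).
    apply/flattenP; exists [seq (u.1 + w.1 / b ^+ K, w.2) | w <- t u.2].
      exact: map_f.
    exact: (map_f (fun w : R * R => (u.1 + w.1 / b ^+ K, w.2))).
  rewrite /= mulSn exprD; move: wx1 wx2; rewrite xK.
  rewrite -ler_pdivrMl// mulrC -lerBrDl => ->/=.
  have -> : u.1 + w.1 / b ^+ K + w.2 / (b ^+ K * b ^+ (q * K)) =
    u.1 + (w.1 + w.2 / b ^+ (q * K)) / b ^+ K by field; rewrite !gt_eqF.
  by rewrite mulrC -ltr_pdivlMr// ltrBlDl.
Qed.

Lemma avoid_small (eps : R) : 0 < eps -> exists N, exists s : seq (R * R),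
  [/\ forall u, u \in s -> 0 < u.2, \sum_(u <- s) u.2 < eps &
      forall x, 0 <= x < 1 ->
        (forall j, (j <= N)%N -> ~~ J (iter j (tau b) x)) ->
        exists2 u, u \in s & u.1 <= x < u.1 + u.2].
Proof.
move=> eps0; have [K [theta [/andP[theta0 theta1] H]]] := avoid_iter.
have theta'1 : 1 < theta^-1 by rewrite invf_gt1.
have [q qP] := expr_unbounded theta'1 eps^-1.
have [s [ssum sC scov]] := H q 1 CC1.
have bn k : 0 < b ^+ k by rewrite exprn_gt0.
exists (q * K)%N, [seq (u.1, u.2 / b ^+ (q * K)) | u <- s]; split.
- by move=> w /mapP[u us ->]/=; rewrite divr_gt0//; apply/CC_gt0/sC.
- rewrite big_map/= -mulr_suml ltr_pdivrMr//; apply: le_lt_trans ssum _.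
  rewrite mulr1 ltr_pM2r//; by move: qP; rewrite exprVn ltf_pV2// posrE exprn_gt0.
- move=> x x01 /(scov x x01)[u us ux]; exists (u.1, u.2 / b ^+ (q * K)) => //.
  exact: (map_f (fun u : R * R => (u.1, u.2 / b ^+ (q * K)))).
Qed.

End Cover.

End GreedyDynamics.

(** * Eigenvectors of matrices with irreducible characteristic polynomial *)

Section HornerEigen.
Context (F : fieldType) (n : nat).
Implicit Types (A : 'M[F]_n.+1) (p q : {poly F}).

Lemma mul_eigen_horner (mu : 'rV[F]_n.+1) A a q :
  mu *m A = a *: mu -> mu *m horner_mx A q = q.[a] *: mu.
Proof.
move=> muA; elim/poly_ind: q => [|q c IH].
  by rewrite rmorph0 mulmx0 horner0 scale0r.
rewrite rmorphD rmorphM /= horner_mx_X horner_mx_C mulmxDr hornerMXaddC.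
rewrite -[_ * A]/(_ *m A) mulmxA IH -scalemxAl muA scalerA scalerDl mul_mx_scalar.
by rewrite mulrC.
Qed.

End HornerEigen.

(** Irreducibility makes every nonzero vector cyclic: a nonzero [q] of smaller degree is coprime to
    [char_poly A], and a Bezout relation evaluated at [A] and applied to [w] gives [w = 0] by
    Cayley-Hamilton. *)
Lemma horner_mx_irreducible_eq0 (F : fieldType) n (A : 'M[F]_n.+1)
    (w : 'cV[F]_n.+1) (q : {poly F}) : irreducible_poly (char_poly A) -> w != 0 ->
  (size q <= n.+1)%N -> horner_mx A q *m w = 0 -> q = 0.
Proof.
move=> irr w0 sq qw; apply/eqP/negPn/negP => q0.
have : coprimep (char_poly A) q.
  rewrite irreducible_poly_coprime//; apply/negP => /(dvdp_leq q0).
  by rewrite size_char_poly leqNgt ltnS sq.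
move=> /Bezout_eq1_coprimepP[[u v]] /= /(congr1 (horner_mx A)).
rewrite rmorphD !rmorphM /= Cayley_Hamilton mulr0 add0r rmorph1.
move=> /(congr1 (fun X => X *m w)); rewrite mul1mx -[_ * _]/(_ *m _) -mulmxA.
by rewrite qw mulmx0 => /esym/eqP; rewrite (negPf w0).
Qed.

(** The vectors [A ^+ j *m w] form a basis, and [mu] takes on each of them the value [a ^+ j] times
    [mu *m w]. So an eigenfunctional is determined by its value at one nonzero rational vector. *)
Lemma eigen_rat_inj (L : numFieldType) n (A : 'M[rat]_n.+1) (w : 'cV[rat]_n.+1)
    (mu : 'rV[L]_n.+1) (a : L) :
  irreducible_poly (char_poly A) -> w != 0 ->
  mu *m map_mx ratr A = a *: mu -> mu *m map_mx ratr w = 0 -> mu = 0.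
Proof.
move=> irr w0 muA muw.
pose K := \matrix_(j < n.+1, i < n.+1) (A ^+ j *m w) i 0.
have KU : K \in unitmx.
  rewrite -row_free_unit; apply: inj_row_free => c cK.
  suff rc0 : rVpoly c = 0 by rewrite -(rVpolyK c) rc0 linear0.
  apply: (horner_mx_irreducible_eq0 irr w0); first exact: size_poly.
  rewrite horner_rVpoly; apply/colP => i; move/rowP/(_ i): cK.
  rewrite [in X in X -> _]mxE [in X in X -> _]mxE => E; rewrite [RHS]mxE -[RHS]E.
  rewrite mulmx_sum_row linear_sum mulmx_suml summxE; apply: eq_bigr => j _.
  by rewrite linearZ /= rowK mxvecK -scalemxAl [LHS]mxE [K _ _]mxE.
have KTU : (map_mx ratr K^T : 'M[L]_n.+1) \in unitmx by rewrite map_unitmx unitmx_tr.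
rewrite -[mu](mulmxK KTU); suff -> : mu *m map_mx ratr K^T = 0 by rewrite mul0mx.
apply/rowP => j; rewrite [RHS]mxE.
have -> : (mu *m map_mx ratr K^T) 0 j = (mu *m map_mx ratr (A ^+ j *m w)) 0 0.
  by rewrite !mxE; apply: eq_bigr => i _; rewrite !mxE.
suff -> : mu *m map_mx ratr (A ^+ j *m w) = 0 by rewrite mxE.
elim: (nat_of_ord j) => [|k IH]; first by rewrite expr0 mul1mx.
rewrite exprS -mulmxE -mulmxA map_mxM mulmxA muA -scalemxAl IH scaler0.
by [].
Qed.


(** * Spectral splitting of a Pisot matrix *)

Section PisotSpectrum.
Context (R : realType) (n : nat) (M : 'M[int]_n.+1) (b : R).
Context (M_pisot : pisot_automorphism M b).

Let MR : 'M[R]_n.+1 := map_mx intr M.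
Let pQ : {poly rat} := map_poly intr (char_poly M).

Lemma ratr_intr_mx (L : numFieldType) m1 m2 (A : 'M[int]_(m1, m2)) :
  map_mx ratr (map_mx intr A : 'M[rat]_(m1, m2)) = map_mx intr A :> 'M[L]_(m1, m2).
Proof. by apply/matrixP => i j; rewrite !mxE ratr_int. Qed.

Lemma ratr_intr_poly (L : numFieldType) (p : {poly int}) :
  map_poly ratr (map_poly intr p : {poly rat}) = map_poly intr p :> {poly L}.
Proof. by rewrite -map_poly_comp; apply: eq_map_poly => x /=; rewrite ratr_int. Qed.

Let irr : irreducible_poly (char_poly (map_mx intr M : 'M[rat]_n.+1)).
Proof. by case: M_pisot; rewrite -map_char_poly. Qed.

Let b_gt1 : 1 < b. Proof. by case: M_pisot => _ _ _ []. Qed.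

Lemma char_polyR : char_poly MR = map_poly ratr pQ.
Proof. by rewrite ratr_intr_poly map_char_poly. Qed.

Lemma char_polyR_root : root (char_poly MR) b.
Proof. by rewrite char_polyR ratr_intr_poly; case: M_pisot. Qed.

Lemma left_eigen_int_inj (mu : 'rV[R]_n.+1) (w : 'cV[int]_n.+1) :
  mu *m MR = b *: mu -> w != 0 -> mu *m map_mx intr w = 0 -> mu = 0.
Proof.
rewrite /MR -[map_mx intr M]ratr_intr_mx -[map_mx intr w]ratr_intr_mx => muM w0.
apply: (eigen_rat_inj irr) muM.
apply: contra w0 => /eqP/colP w0; apply/eqP/colP => i; move: (w0 i).
by rewrite !mxE => /eqP; rewrite intr_eq0 => /eqP.
Qed.

Lemma left_eigen_exists : exists2 lam : 'rV[R]_n.+1, lam != 0 & lam *m MR = b *: lam.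
Proof.
have : eigenvalue MR b by rewrite eigenvalue_root_char char_polyR_root.
by case/eigenvalueP => lam lamM lam0; exists lam.
Qed.

(** Pairing with the first basis vector, an integer vector, is injective on the eigenspace. *)
Lemma left_eigen_dim1 (lam mu : 'rV[R]_n.+1) : lam != 0 ->
  lam *m MR = b *: lam -> mu *m MR = b *: mu -> mu = (mu 0 0 / lam 0 0) *: lam.
Proof.
move=> lam0 lamM muM.
have row0 (nu : 'rV[R]_n.+1) : nu *m MR = b *: nu -> nu 0 0 = 0 -> nu = 0.
  move=> nuM nu0; apply: (@left_eigen_int_inj nu (delta_mx 0 0)) => //.
    by apply/eqP => /matrixP/(_ 0 0); rewrite !mxE.
  apply/matrixP => i j; rewrite !ord1 !mxE (bigD1 ord0)//= big1 ?addr0.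
    by rewrite !mxE nu0 mul0r.
  by move=> k k0; rewrite !mxE (negPf k0) mulr0.
have l00 : lam 0 0 != 0.
  by apply: contra lam0 => /eqP l00; rewrite (row0 lam).
apply/eqP; rewrite -subr_eq0; apply/eqP/row0.
  by rewrite mulmxBl -scalemxAl muM lamM scalerBr !scalerA mulrC.
by rewrite !mxE mulfVK// subrr.
Qed.

(** [b] is a simple root, because an irreducible rational polynomial is coprime to its
    derivative. *)
Lemma char_poly_cofactor : exists g : {poly R},
  char_poly MR = g * ('X - b%:P) /\ g.[b] != 0.
Proof.
have /factor_theorem[g gE] := char_polyR_root; exists g; split=> //.
have pQirr : irreducible_poly pQ by case: M_pisot.
have pQ1 : (1 < size pQ)%N by case: pQirr.
have : coprimep pQ pQ^`().
  have p0 : pQ != 0 by rewrite -size_poly_gt0 ltnW.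
  have d0 : pQ^`() != 0.
    apply/eqP => /(congr1 (fun q : {poly rat} => q`_(size pQ).-2)).
    rewrite coef_deriv coef0 => /eqP; rewrite mulrn_eq0 /=.
    rewrite prednK; last by case: (size pQ) pQ1 => [|[]].
    by rewrite -/(lead_coef pQ) lead_coef_eq0 (negPf p0).
  rewrite irreducible_poly_coprime//; apply/negP => /(dvdp_leq d0).
  by rewrite leqNgt lt_size_deriv.
rewrite -(coprimep_map (ratr : {rmorphism rat -> R})) => cop.
have := char_polyR_root; rewrite char_polyR => /(coprimep_root cop).
rewrite -deriv_map -char_polyR gE derivM derivXsubC hornerD !hornerM hornerXsubC.
by rewrite subrr mulr0 add0r hornerC mulr1.
Qed.

(** By Cayley-Hamilton the rows of [horner_mx MR g] are left eigenvectors for [b] and its columns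
    right ones. As the left eigenspace is a line, this matrix is, up to the factor [g.[b]], the
    projection onto the expanding line, and [v] is read off its first column. *)
Lemma spectral_data : exists (lam : 'rV[R]_n.+1) (v : 'cV[R]_n.+1) (g : {poly R}),
  [/\ lam *m MR = b *: lam, MR *m v = b *: v, lam *m v = 1%:M,
      char_poly MR = g * ('X - b%:P) /\ g.[b] != 0 &
      horner_mx MR g = g.[b] *: (v *m lam)].
Proof.
have [lam lam0 lamM] := left_eigen_exists.
have [g [gE gb]] := char_poly_cofactor.
pose W := horner_mx MR g.
have WM : W *m MR = b *: W.
  have := congr1 (horner_mx MR) gE; rewrite Cayley_Hamilton rmorphM rmorphB /=.
  rewrite horner_mx_X horner_mx_C mulrBr => /esym/eqP; rewrite subr_eq0 => /eqP.
  by rewrite -![_ * _]/(_ *m _) => ->; rewrite mul_mx_scalar.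
have MW : MR *m W = b *: W.
  by rewrite -WM; exact: (comm_mx_horner g (comm_mx_refl MR)).
have lamW : lam *m W = g.[b] *: lam by exact: mul_eigen_horner.
have l00 : lam 0 0 != 0.
  apply: contraNneq (lam0) => l00; apply/eqP.
  by rewrite (left_eigen_dim1 lam0 lamM lamM) l00 mul0r scale0r.
pose v := (g.[b] * lam 0 0)^-1 *: col 0 W.
have WE : W = g.[b] *: (v *m lam).
  apply/row_matrixP => i; rewrite (left_eigen_dim1 lam0 lamM (mu := row i W)); last first.
    by rewrite -row_mul WM linearZ.
  apply/rowP => j; rewrite !mxE big_ord1 !mxE; field; exact/andP.
have vE : lam *m v = 1%:M.
  have : (lam *m v) *m lam = lam.
    apply: (scalerI gb); by rewrite -mulmxA scalemxAr -WE.
  rewrite [lam *m v]mx11_scalar mul_scalar_mx => /rowP/(_ 0); rewrite mxE.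
  by rewrite -{2}[lam 0 0]mul1r => /(mulIf l00) ->.
exists lam, v, g; split=> //.
by rewrite /v -scalemxAr colE mulmxA MW -scalemxAl scalerA mulrC -scalerA.
Qed.

Lemma summable_of_roots (L : numFieldType) (A : 'M[L]_n.+1) (rs : seq L) :
  (forall z, z \in rs -> `|z| < 1) ->
  forall y : 'cV[L]_n.+1, horner_mx A (\prod_(z <- rs) ('X - z%:P)) *m y = 0 ->
  forall i, exists C : L, forall K, \sum_(k < K) `|(A ^+ k *m y) i 0| <= C.
Proof.
elim: rs => [_ y|z rs IH rs1 y].
  rewrite big_nil rmorph1 mul1mx => -> i; exists 0 => K.
  by rewrite big1// => k _; rewrite mulmx0 mxE normr0.
have z1 : `|z| < 1 by apply: rs1; rewrite mem_head.
pose y' := A *m y - z *: y.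
have yS k : A ^+ k.+1 *m y = z *: (A ^+ k *m y) + A ^+ k *m y'.
  by rewrite /y' mulmxBr -scalemxAr addrC subrK mulmxA exprSr.
rewrite big_cons mulrC rmorphM rmorphB /= horner_mx_X horner_mx_C -mulmxE -mulmxA.
rewrite mulmxBl mul_scalar_mx => y'0 i.
have [|C CP] := IH _ y' y'0 i.
  by move=> w wrs; apply: rs1; rewrite inE wrs orbT.
have C0 : 0 <= C by have := CP 0%N; rewrite big_ord0.
have z0 : 0 < 1 - `|z| by rewrite subr_gt0.
exists ((`|y i 0| + C) / (1 - `|z|)); elim=> [|K IHK].
  by rewrite big_ord0; apply: divr_ge0; [exact: addr_ge0|exact: ltW].
rewrite big_ord_recl expr0 mul1mx.
apply: (@le_trans _ _ (`|y i 0| + (`|z| * ((`|y i 0| + C) / (1 - `|z|)) + C))).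
  rewrite lerD2l; apply: le_trans (lerD (ler_wpM2l (normr_ge0 z) IHK) (CP K)).
  rewrite mulr_sumr -big_split /=; apply: ler_sum => k _.
  by rewrite yS [in leLHS]mxE [X in `|X + _|]mxE (le_trans (ler_normD _ _))// normrM.
rewrite le_eqVlt; apply/orP; left; apply/eqP; field.
by rewrite gt_eqF.
Qed.

Lemma norm_colE_le (x : 'cV[R]_n.+1) : `|x| <= \sum_i `|x i 0|.
Proof.
rewrite [leLHS]mx_normrE; apply: bigmax_le => [|[i j] _]; first exact: sumr_ge0.
by rewrite ord1 (bigD1 i)//= lerDl sumr_ge0.
Qed.

Lemma norm_coord_le m1 (x : 'cV[R]_m1) i : `|x i 0| <= `|x|.
Proof. by rewrite [leRHS]mx_normrE (le_bigmax _ _ (i, 0)). Qed.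

(** [horner_mx MR g] vanishes on the kernel of [lam]. The complex roots of [g] are conjugates of [b]
    and differ from [b] since [g.[b] != 0], so all have modulus less than 1. *)
Lemma stable_summable (lam : 'rV[R]_n.+1) (v : 'cV[R]_n.+1) (g : {poly R}) :
  char_poly MR = g * ('X - b%:P) -> g.[b] != 0 ->
  horner_mx MR g = g.[b] *: (v *m lam) ->
  forall x : 'cV[R]_n.+1, lam *m x = 0 ->
  exists C : R, forall K, \sum_(k < K) `|MR ^+ k *m x| <= C.
Proof.
move=> gE gb gW x lamx.
have gx : horner_mx MR g *m x = 0 by rewrite gW -scalemxAl -mulmxA lamx mulmx0 scaler0.
pose f : {rmorphism R -> R[i]} := real_complex R.
have [rs rsE] := closed_field_poly_normal (map_poly f g).
have g0 : g != 0 by apply: contraNneq gb => ->; rewrite horner0.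
have lg0 : lead_coef (map_poly f g) != 0.
  by rewrite lead_coef_eq0 map_poly_eq0.
have rs1 z : z \in rs -> `|z| < 1.
  move=> zrs; have gz : root (map_poly f g) z.
    by rewrite rsE rootZ// root_prod_XsubC.
  have [_ _ _ [_ _]] := M_pisot; apply.
    exists pQ; split.
      split; [by rewrite /pQ map_char_poly char_poly_monic|by case: M_pisot|].
      by rewrite -char_polyR char_polyR_root.
    have -> : map_poly ratr pQ = map_poly f (map_poly ratr pQ) :> {poly R[i]}.
      by apply/polyP => j; rewrite !coef_map /= -[RHS]/(f _) fmorph_rat.
    by rewrite -char_polyR gE rmorphM rootM gz.
  apply: contraNneq gb => zb; move: gz; rewrite zb /root.
  by rewrite -[X in _.[X]]/(f b) horner_map fmorph_eq0.
have fx : horner_mx (map_mx f MR) (\prod_(z <- rs) ('X - z%:P)) *m map_mx f x = 0.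
  have := congr1 (map_mx f) gx; rewrite map_mxM map_horner_mx rsE map_mx0.
  rewrite linearZ /= -scalemxAl => /eqP; rewrite scaler_eq0 (negPf lg0)/=.
  by move/eqP.
have coord i : exists C : R, forall K, \sum_(k < K) `|(MR ^+ k *m x) i 0| <= C.
  have [C CP] := summable_of_roots rs1 fx i; exists (complex.Re C) => K.
  have := CP K; have : f (\sum_(k < K) `|(MR ^+ k *m x) i 0|) <=
      \sum_(k < K) `|(map_mx f MR ^+ k *m map_mx f x) i 0|.
    rewrite rmorph_sum; apply: ler_sum => k _.
    have -> : map_mx f MR ^+ k *m map_mx f x = map_mx f (MR ^+ k *m x).
      by rewrite map_mxM rmorphXn.
    by rewrite [X in _ <= `|X|]mxE; exact: (normc_ge_Re (f _)).
  by move=> /le_trans H /H; rewrite lecE => /andP[].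
have /choice[C CP] : forall i, exists C : R, forall K, \sum_(k < K) `|(MR ^+ k *m x) i 0| <= C.
  exact: coord.
exists (\sum_i C i) => K.
apply: (@le_trans _ _ (\sum_(k < K) \sum_i `|(MR ^+ k *m x) i 0|)).
  by apply: ler_sum => k _; exact: norm_colE_le.
by rewrite exchange_big; apply: ler_sum => i _; exact: CP.
Qed.

End PisotSpectrum.

(** * Integer vectors, and the unit [b] *)

Section IntegerVectors.
Context (R : realType).

Lemma int_vec_small m (l : 'cV[int]_m) : `|map_mx intr l : 'cV[R]_m| < 1 -> l = 0.
Proof.
move=> l1; apply/colP => i; rewrite mxE; apply/eqP; rewrite -normr_eq0.
have := le_lt_trans (norm_coord_le (map_mx intr l : 'cV[R]_m) i) l1.
rewrite mxE -intr_norm -(mulr1z (1 : R)) ltr_int.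
by have := normr_ge0 (l i 0); lia.
Qed.

Lemma int_vec_finite m (B : R) : exists s : seq 'cV[int]_m,
  forall l, `|map_mx intr l : 'cV[R]_m| <= B -> l \in s.
Proof.
pose N := (Num.truncn B).+1.
exists [seq \col_i ((f i : nat)%:Z - N%:Z) | f : {ffun 'I_m -> 'I_(2 * N).+1}].
move=> l lB; have lN i : `|l i 0| <= N%:Z.
  rewrite -(ler_int R) intr_norm; apply: le_trans (ltW (truncnS_gt B)).
  by have := norm_coord_le (map_mx intr l : 'cV[R]_m) i; rewrite mxE => /le_trans; apply.
apply/mapP; exists [ffun i => inord (absz (l i 0 + N%:Z))]; first by rewrite mem_enum.
apply/colP => i; rewrite mxE ffunE; have := lN i; move: (l i 0) (N) => z K zK.
by rewrite inordK; lia.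
Qed.

End IntegerVectors.

Section PisotUnit.
Context (R : realType) (n : nat) (M : 'M[int]_n.+1) (b : R).
Context (M_pisot : pisot_automorphism M b).

(** The characteristic polynomial is [q * 'X] plus a constant term, the determinant up to sign,
    which is invertible in the integers. Hence the inverse of [b] is an integer multiple of the
    value of [q] at [b]. *)
Lemma Z_adjoin_div x : Z_adjoin b x -> Z_adjoin b (x / b).
Proof.
move=> xZ; have [MU _ pb [b1 _ _]] := M_pisot.
apply: Z_adjoinM => //; pose p := char_poly M.
pose q := \poly_(i < size p) p`_i.+1.
have pE : p = q * 'X + (p`_0)%:P.
  apply/polyP => -[|i]; rewrite coefD coefMX coefC ?add0r ?addr0//=.
  by rewrite coef_poly; case: ltnP => // /leqW H; rewrite nth_default.
have dd : \det M * \det (invmx M) = 1 by rewrite -det_mulmx mulmxV// det1.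
have [c c1] : exists c : int, c * p`_0 = 1.
  exists ((-1) ^+ n.+1 * \det (invmx M)).
  by rewrite char_poly_det mulrACA -expr2 sqrr_sign mul1r mulrC.
exists ((- c)%:P * q) => //.
have : (map_poly intr p).[b] = 0 :> R by exact/eqP.
rewrite pE rmorphD !rmorphM /= map_polyX map_polyC hornerD hornerMX hornerC => E.
have b0 : b != 0 by rewrite gt_eqF// (lt_trans ltr01).
apply: (mulIf b0); rewrite mulVf// map_polyC hornerM hornerC /= intrN.
have E' : (map_poly intr q).[b] * b = - (p`_0)%:~R.
  by apply/eqP; rewrite -addr_eq0; apply/eqP.
by rewrite mulNr mulNr -mulrA E' mulrN opprK -intrM c1.
Qed.

(** Negative powers of [M] preserve integrality and contract the expanding line, so some iterate is
    an integer vector of norm less than 1. *)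
Lemma eigen_line_int (v : 'cV[R]_n.+1) (w : 'cV[int]_n.+1) c :
  map_mx intr M *m v = b *: v -> map_mx intr w = c *: v -> w = 0.
Proof.
have [MU _ _ [b1 _ _]] := M_pisot; move=> Mv wv.
have b0 : 0 < b by rewrite (lt_trans ltr01).
have VM (x : 'cV[R]_n.+1) : map_mx intr (invmx M) *m (map_mx intr M *m x) = x.
  by rewrite mulmxA -map_mxM mulVmx// map_mx1 mul1mx.
have Vv : map_mx intr (invmx M) *m v = b^-1 *: v.
  by rewrite -[RHS]VM -scalemxAr Mv scalerA mulVf ?gt_eqF// scale1r.
have Vk k : map_mx intr (invmx M ^+ k *m w) = (b ^- k * c) *: v.
  elim: k => [|k IH]; first by rewrite expr0 mul1mx invr1 mul1r.
  rewrite exprS -mulmxE -mulmxA map_mxM IH -scalemxAr Vv scalerA exprS invfM.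
  by congr (_ *: _); ring.
have [k kP] := expr_unbounded b1 (`|c| * `|v|).
have /int_vec_small w0 : `|map_mx intr (invmx M ^+ k *m w) : 'cV[R]_n.+1| < 1.
  have bk : 0 < b ^+ k by rewrite exprn_gt0.
  by rewrite Vk normrZ normrM normfV (gtr0_norm bk) -mulrA mulrC ltr_pdivrMr// mul1r.
have -> : w = M ^+ k *m (invmx M ^+ k *m w).
  elim: (k) => [|j IH]; first by rewrite !expr0 !mul1mx.
  rewrite exprSr exprS -!mulmxE -!mulmxA (mulmxA M) mulmxV// mul1mx.
  exact: IH.
by rewrite w0 mulmx0.
Qed.

End PisotUnit.

(** * Group structure and topology of the torus *)

Section TorusTheory.
Context (R : realType) (m : nat).
Local Notation pi := (@to_torus R m).
Local Notation iv := (map_mx intr : 'cV[int]_m -> 'cV[R]_m).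

Lemma to_torusD x y : pi (x + y) = pi x + pi y.
Proof. exact: Quotient.pi_add. Qed.

Lemma to_torusN x : pi (- x) = - pi x.
Proof. exact: Quotient.pi_opp. Qed.

Lemma to_torus0 : pi 0 = 0.
Proof. by apply: (addrI (pi 0)); rewrite -to_torusD !addr0. Qed.

Lemma to_torusB x y : pi (x - y) = pi x - pi y.
Proof. by rewrite to_torusD to_torusN. Qed.

Lemma to_torusMn x k : pi (x *+ k) = pi x *+ k.
Proof. by elim: k => [|k IH]; rewrite ?mulr0n ?to_torus0// !mulrS to_torusD IH. Qed.

Lemma to_torus_sum (I : Type) (r : seq I) (P : pred I) (F : I -> 'cV[R]_m) :
  pi (\sum_(i <- r | P i) F i) = \sum_(i <- r | P i) pi (F i).
Proof. by apply: (big_morph pi to_torusD to_torus0). Qed.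

Lemma to_torus_repr (x : torus R m) : pi (repr x) = x.
Proof. exact: reprK. Qed.

Lemma ZlatticeP x : reflect (exists l, x = iv l) (x \in @Zlattice R m).
Proof.
apply: (iffP mxOverP) => [xZ|[l ->] i j]; last by rewrite mxE intr_int.
exists (\col_i Num.floor (x i 0)); apply/colP => i; rewrite !mxE.
by rewrite floorK.
Qed.

Lemma to_torus_eq x y : pi x = pi y <-> exists l, x = y + iv l.
Proof.
split=> [xy|[l ->]].
  have : x - y \in @Zlattice R m by rewrite Quotient.idealrBE; apply/eqP; exact: xy.
  by move=> /ZlatticeP[l xyl]; exists l; rewrite -xyl addrC subrK.
have : y + iv l - y \in @Zlattice R m.
  by apply/ZlatticeP; exists l; rewrite addrAC subrr add0r.
by rewrite Quotient.idealrBE => /eqP.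
Qed.

Lemma to_torus_iv l : pi (iv l) = 0.
Proof. by rewrite -to_torus0; apply/to_torus_eq; exists l; rewrite add0r. Qed.

Lemma to_torus_continuous : continuous pi.
Proof. exact: pi_continuous. Qed.

Lemma open_translate (A : set 'cV[R]_m) a : open A -> open [set x | A (x + a)].
Proof.
move=> oA; apply: open_comp oA => x _.
by apply: (@cvgD _ _ _ (nbhs x) _ id (fun=> a) x a); [exact: cvg_id|exact: cvg_cst].
Qed.

Lemma to_torus_open (A : set 'cV[R]_m) : open A -> open (pi @` A).
Proof.
move=> oA; rewrite /open/= /quotient_open.
suff -> : pi @^-1` (pi @` A) = \bigcup_l [set x | A (x + iv l)].
  by apply: bigcup_open => l _; exact: open_translate.
apply/seteqP; split=> x /=.
  move=> [y Ay /to_torus_eq[l yx]]; exists l => //=.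
  by rewrite -yx.
move=> [l _ /= Ax]; exists (x + iv l) => //; apply/to_torus_eq; by exists l.
Qed.

Lemma near_int_is_int (r : R) :
  (forall e, 0 < e -> exists k : int, `|r - k%:~R| < e) -> exists k : int, r = k%:~R.
Proof.
move=> H; exists (Num.floor r); apply/eqP; rewrite eq_le; apply/andP; split; last first.
  exact: floor_le_tmp.
rewrite leNgt; apply/negP => fr; have := floorD1_gt r; rewrite intrD => fr1.
have [|k kP] := H (Num.min (r - (Num.floor r)%:~R) ((Num.floor r)%:~R + 1 - r)).
  by rewrite lt_min !subr_gt0 fr fr1.
move: kP; rewrite lt_min !ltr_norml => /andP[/andP[a1 a2] /andP[a3 a4]].
have : (Num.floor r)%:~R < k%:~R :> R by lra.
have : k%:~R < (Num.floor r)%:~R + 1 :> R by lra.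
by rewrite -[X in _ + X]/(1%:~R) -intrD !ltr_int; lia.
Qed.

Lemma near_lattice (p : 'cV[R]_m) :
  (forall e, 0 < e -> exists l, `|p - iv l| < e) -> exists l, p = iv l.
Proof.
move=> H; have /choice[f fP] : forall i, exists k : int, p i 0 = k%:~R.
  move=> i; apply: near_int_is_int => e /H[l le]; exists (l i 0).
  by apply: le_lt_trans le; have := norm_coord_le (p - iv l) i; rewrite !mxE.
by exists (\col_i f i); apply/colP => i; rewrite fP !mxE.
Qed.

(** Cosets are separated because the lattice is closed, by [near_lattice]. Separation is what allows
    the limits in [phi] to be evaluated. *)
Lemma torus_hausdorff : hausdorff_space (torus R m).
Proof.
move=> x y xy; apply: contrapT; rewrite -(to_torus_repr x) -(to_torus_repr y).
set p := repr x; set q := repr y => npq.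
have [e e0 eP] : exists2 e, 0 < e & forall l, e <= `|p - q - iv l|.
  apply: contrapT => H; apply: npq; apply/to_torus_eq.
  have [e e0|l pq] := @near_lattice (p - q).
    apply: contrapT => H'; apply: H; exists e => // l.
    by rewrite leNgt; apply/negP => le; apply: H'; exists l.
  by exists l; rewrite -pq addrC subrK.
have nb (z : torus R m) : nbhs z (pi @` ball (repr z) (e / 2)).
  apply: open_nbhs_nbhs; split; last first.
    by exists (repr z); [apply: ballxx; rewrite divr_gt0|rewrite to_torus_repr].
  by apply: to_torus_open; exact: ball_open.
have [z [[p' pp' <-] [q' qq' /to_torus_eq[l qp]]]] := xy _ _ (nb x) (nb y).
have := eP (- l); rewrite leNgt => /negP; apply.
move: pp' qq'; rewrite -!ball_normE /= -/p -/q => pp' qq'.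
have -> : p - q - iv (- l) = (p - p') - (q - q').
  by rewrite qp; apply/colP => i; rewrite !mxE intrN; ring.
by apply: le_lt_trans (ler_normB _ _) _; rewrite (splitr e) ltrD.
Qed.

Lemma toral_mapE (A : 'M[int]_m) x : toral_map A (pi x) = pi (map_mx intr A *m x).
Proof.
rewrite /toral_map; have /to_torus_eq[l ->] := to_torus_repr (pi x).
by rewrite mulmxDr -map_mxM to_torusD to_torus_iv addr0.
Qed.

End TorusTheory.

(** * Stable and unstable parts of a vector *)

Section Splitting.
Context (R : realType) (n : nat).
Implicit Types (lam : 'rV[R]_n.+1) (v x y : 'cV[R]_n.+1).

Definition ucoord lam x : R := (lam *m x) 0 0.
Definition stab lam v x : 'cV[R]_n.+1 := x - ucoord lam x *: v.

Lemma ucoordD lam x y : ucoord lam (x + y) = ucoord lam x + ucoord lam y.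
Proof. by rewrite /ucoord mulmxDr mxE. Qed.

Lemma ucoordZ lam a x : ucoord lam (a *: x) = a * ucoord lam x.
Proof. by rewrite /ucoord -scalemxAr mxE. Qed.

Lemma ucoordN lam x : ucoord lam (- x) = - ucoord lam x.
Proof. by rewrite -scaleN1r ucoordZ mulN1r. Qed.

Lemma ucoordB lam x y : ucoord lam (x - y) = ucoord lam x - ucoord lam y.
Proof. by rewrite ucoordD ucoordN. Qed.

Lemma ucoord0 lam : ucoord lam 0 = 0.
Proof. by rewrite /ucoord mulmx0 mxE. Qed.

Lemma ucoord_eq0 lam x : ucoord lam x = 0 -> lam *m x = 0.
Proof. by move=> E; apply/matrixP => i j; rewrite !ord1 [RHS]mxE. Qed.

Lemma mulmx_bound (A : 'M[R]_n.+1) : exists2 C, 0 <= C & forall x, `|A *m x| <= C * `|x|.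
Proof.
exists (\sum_i \sum_j `|A i j|).
  by apply: sumr_ge0 => i _; apply: sumr_ge0.
move=> x; apply: le_trans (norm_colE_le _) _; rewrite mulr_suml; apply: ler_sum => i _.
rewrite mxE mulr_suml; apply: le_trans (ler_norm_sum _ _ _) _; apply: ler_sum => j _.
by rewrite normrM ler_wpM2l// norm_coord_le.
Qed.

Lemma ucoord_bound lam : exists2 C, 0 <= C & forall x, `|ucoord lam x| <= C * `|x|.
Proof.
exists (\sum_j `|lam 0 j|); first exact: sumr_ge0.
move=> x; rewrite /ucoord mxE mulr_suml; apply: le_trans (ler_norm_sum _ _ _) _.
by apply: ler_sum => j _; rewrite normrM ler_wpM2l// norm_coord_le.
Qed.

Lemma stabD lam v x y : stab lam v (x + y) = stab lam v x + stab lam v y.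
Proof. by rewrite /stab ucoordD scalerDl opprD addrACA. Qed.

Lemma stabZ lam v a x : stab lam v (a *: x) = a *: stab lam v x.
Proof. by rewrite /stab ucoordZ scalerBr scalerA. Qed.

Lemma stabN lam v x : stab lam v (- x) = - stab lam v x.
Proof. by rewrite -scaleN1r stabZ scaleN1r. Qed.

Lemma stabB lam v x y : stab lam v (x - y) = stab lam v x - stab lam v y.
Proof. by rewrite stabD stabN. Qed.

Lemma stab_decomp lam v x : x = stab lam v x + ucoord lam x *: v.
Proof. by rewrite /stab subrK. Qed.

End Splitting.

(** * Homoclinic points as stable parts of integer vectors *)

Section PisotSplitting.
Context (R : realType) (n : nat) (M : 'M[int]_n.+1) (b : R).
Context (M_pisot : pisot_automorphism M b).
Local Notation MR := (map_mx intr M : 'M[R]_n.+1).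
Local Notation VR := (map_mx intr (invmx M) : 'M[R]_n.+1).
Local Notation iv := (map_mx intr : 'cV[int]_n.+1 -> 'cV[R]_n.+1).
Local Notation pi := (@to_torus R n.+1).

Let b_gt1 : 1 < b. Proof. by case: M_pisot => _ _ _ []. Qed.
Let b_gt0 : 0 < b. Proof. exact: lt_trans b_gt1. Qed.
Let MU : M \in unitmx. Proof. by case: M_pisot. Qed.

Lemma MVR (x : 'cV[R]_n.+1) : MR *m (VR *m x) = x.
Proof. by rewrite mulmxA -map_mxM mulmxV// map_mx1 mul1mx. Qed.

Lemma VMR (x : 'cV[R]_n.+1) : VR *m (MR *m x) = x.
Proof. by rewrite mulmxA -map_mxM mulVmx// map_mx1 mul1mx. Qed.

Lemma MVRX k (x : 'cV[R]_n.+1) : MR ^+ k *m (VR ^+ k *m x) = x.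
Proof.
elim: k x => [|k IH] x; first by rewrite !expr0 !mul1mx.
by rewrite exprSr exprS -!mulmxE -!mulmxA MVR IH.
Qed.

Lemma VMRX k (x : 'cV[R]_n.+1) : VR ^+ k *m (MR ^+ k *m x) = x.
Proof.
elim: k x => [|k IH] x; first by rewrite !expr0 !mul1mx.
by rewrite exprSr exprS -!mulmxE -!mulmxA VMR IH.
Qed.

Lemma MRX_iv k w : MR ^+ k *m iv w = iv (M ^+ k *m w).
Proof. by rewrite map_mxM rmorphXn. Qed.

Lemma VRX_iv k w : VR ^+ k *m iv w = iv (invmx M ^+ k *m w).
Proof. by rewrite map_mxM rmorphXn. Qed.

Lemma iter_toral_mapE (A : 'M[int]_n.+1) k (x : 'cV[R]_n.+1) :
  iter k (toral_map A) (pi x) = pi (map_mx intr A ^+ k *m x).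
Proof.
elim: k => [|k IH]; first by rewrite expr0 mul1mx.
by rewrite /= IH toral_mapE exprS -mulmxE mulmxA.
Qed.

Lemma toral_iter_posE k (x : 'cV[R]_n.+1) : toral_iter M k%:Z (pi x) = pi (MR ^+ k *m x).
Proof. exact: iter_toral_mapE. Qed.

Lemma toral_iter_negE k (x : 'cV[R]_n.+1) :
  toral_iter M (- k%:Z) (pi x) = pi (VR ^+ k *m x).
Proof.
case: k => [|k]; first by rewrite oppr0 toral_iter_posE.
by rewrite -NegzE; exact: (iter_toral_mapE (invmx M)).
Qed.

(* A torus orbit tending to 0 is eventually an orbit in R^m: small
   representatives of consecutive points differ by a small lattice vector. *)
Lemma orbit_to0_lift (A : 'M[int]_n.+1) (x : nat -> torus R n.+1) :
  (forall k, x k.+1 = toral_map A (x k)) -> x k @[k --> \oo] --> (0 : torus R n.+1) ->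
  exists k0 y, x k0 = pi y /\ forall j, `|map_mx intr A ^+ j *m y| <= 1 :> R.
Proof.
move=> xS x0; have [C C0 CP] := mulmx_bound (map_mx intr A : 'M[R]_n.+1).
pose e := (C + 1)^-1.
have C1 : 0 < C + 1 by rewrite ltr_wpDl.
have e0 : 0 < e by rewrite invr_gt0.
have e1 : e <= 1 by rewrite invf_le1// lerDr.
have nb : nbhs (0 : torus R n.+1) (pi @` ball 0 e).
  apply: open_nbhs_nbhs; split; last first.
    by exists 0; [exact: ballxx|rewrite to_torus0].
  by apply: to_torus_open; exact: ball_open.
have [k0 _ k0P] := x0 _ nb.
have small k : (k0 <= k)%N -> exists2 y : 'cV[R]_n.+1, `|y| < e & x k = pi y.
  move=> kk; have [y] := k0P k kk; rewrite -ball_normE /= sub0r normrN => ye <-.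
  by exists y.
have [y ye xy] := small _ (leqnn k0); exists k0, y; split=> //.
suff H j : `|map_mx intr A ^+ j *m y| < e /\ x (k0 + j)%N = pi (map_mx intr A ^+ j *m y).
  by move=> j; have [/ltW je _] := H j; exact: le_trans je e1.
elim: j => [|j [IH1 IH2]]; first by rewrite expr0 mul1mx addn0.
have [y' y'e xy'] := small (k0 + j.+1)%N (leq_addr _ _).
have E := IH2; rewrite addnS xS IH2 toral_mapE mulmxA mulmxE -exprS in xy' *.
have /to_torus_eq[l lE] := xy'.
suff l0 : l = 0 by rewrite {1}lE l0 map_mx0 addr0; split=> //; rewrite lE l0 map_mx0 addr0.
apply: (@int_vec_small R).
have -> : map_mx intr l = map_mx intr A *m (map_mx intr A ^+ j *m y) - y'.
  by rewrite mulmxA mulmxE -exprS lE addrC addKr.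
apply: le_lt_trans (ler_normB _ _) _.
have : C * `|map_mx intr A ^+ j *m y| <= C * e by rewrite ler_wpM2l// ltW.
have := CP (map_mx intr A ^+ j *m y).
have : C * e + e = 1 by rewrite /e; field; rewrite gt_eqF.
lra.
Qed.

Context (lam : 'rV[R]_n.+1) (v : 'cV[R]_n.+1).
Context (lamM : lam *m MR = b *: lam) (Mv : MR *m v = b *: v) (lamv : ucoord lam v = 1).
Context (lam_sum : forall x : 'cV[R]_n.+1, ucoord lam x = 0 ->
  exists C : R, forall K, \sum_(k < K) `|MR ^+ k *m x| <= C).
Local Notation L := (ucoord lam).
Local Notation Ps := (stab lam v).

Lemma ucoord_stab x : L (Ps x) = 0.
Proof. by rewrite ucoordB ucoordZ lamv mulr1 subrr. Qed.

Lemma stab_v a : Ps (a *: v) = 0.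
Proof. by rewrite /stab ucoordZ lamv mulr1 subrr. Qed.

Lemma stab_id x : L x = 0 -> Ps x = x.
Proof. by move=> Lx; rewrite /stab Lx scale0r subr0. Qed.

Lemma ucoordM x : L (MR *m x) = b * L x.
Proof. by rewrite /ucoord mulmxA lamM -scalemxAl mxE. Qed.

Lemma ucoordMX k x : L (MR ^+ k *m x) = b ^+ k * L x.
Proof.
elim: k => [|k IH]; first by rewrite !expr0 mul1mx mul1r.
by rewrite exprS -mulmxE -mulmxA ucoordM IH exprS mulrA.
Qed.

Lemma ucoordVX k x : L (VR ^+ k *m x) = L x / b ^+ k.
Proof. by rewrite -[in RHS](MVRX k x) ucoordMX mulrC mulKf// gt_eqF// exprn_gt0. Qed.

Lemma MvX k : MR ^+ k *m v = b ^+ k *: v.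
Proof.
elim: k => [|k IH]; first by rewrite !expr0 mul1mx scale1r.
by rewrite exprS -mulmxE -mulmxA IH -scalemxAr Mv scalerA exprSr.
Qed.

Lemma VvX k : VR ^+ k *m v = (b ^+ k)^-1 *: v.
Proof.
by rewrite -[RHS](VMRX k) -scalemxAr MvX scalerA mulVf ?scale1r// gt_eqF// exprn_gt0.
Qed.

Lemma stabM k x : Ps (MR ^+ k *m x) = MR ^+ k *m Ps x.
Proof. by rewrite /stab mulmxBr ucoordMX -scalemxAr MvX scalerA mulrC. Qed.

Lemma stabV k x : Ps (VR ^+ k *m x) = VR ^+ k *m Ps x.
Proof. by rewrite /stab mulmxBr ucoordVX -scalemxAr VvX scalerA. Qed.

(** The vectors [z j] may vary with [j]: expansion in the standard basis reduces the sum to finitely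
    many summable orbits. This form serves both to kill the stable part of a bounded backward orbit
    and to contract errors that are only known to be bounded. *)
Lemma stab_uniform_sum : exists2 C : R, 0 <= C &
  forall (z : nat -> 'cV[R]_n.+1) B, (forall j, `|z j| <= B) ->
  forall K, \sum_(j < K) `|MR ^+ j *m Ps (z j)| <= C * B.
Proof.
have /choice[c cP] : forall i : 'I_n.+1, exists C : R, forall K,
    \sum_(k < K) `|MR ^+ k *m Ps (delta_mx i 0)| <= C.
  by move=> i; apply: lam_sum; rewrite ucoord_stab.
exists (\sum_i c i).
  by apply: sumr_ge0 => i _; have := cP i 0%N; rewrite big_ord0.
move=> z B zB K; rewrite mulr_suml.
apply: (@le_trans _ _ (\sum_(j < K) \sum_i `|MR ^+ j *m Ps (delta_mx i 0)| * B)).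
  apply: ler_sum => j _.
  have -> : z j = \sum_i z j i 0 *: delta_mx i 0.
    by rewrite [LHS]matrix_sum_delta; apply: eq_bigr => i _; rewrite big_ord1.
  have -> : MR ^+ j *m Ps (\sum_i z j i 0 *: delta_mx i 0) =
      \sum_i z j i 0 *: (MR ^+ j *m Ps (delta_mx i 0)).
    rewrite (big_morph Ps (stabD lam v) (id1 := 0)); last by rewrite stab_id ?ucoord0.
    by rewrite mulmx_sumr; apply: eq_bigr => i _; rewrite stabZ -scalemxAr.
  apply: le_trans (ler_norm_sum _ _ _) _; apply: ler_sum => i _.
  by rewrite normrZ mulrC ler_wpM2l// (le_trans (norm_coord_le _ _)).
rewrite exchange_big; apply: ler_sum => i _; rewrite -mulr_suml ler_wpM2r//.
exact: le_trans (normr_ge0 _) (zB 0%N).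
Qed.

Lemma stable_cvg0 x : L x = 0 -> (MR ^+ k *m x) @[k --> \oo] --> (0 : 'cV[R]_n.+1).
Proof.
move=> Lx; apply: norm_cvg0; have [C CP] := lam_sum Lx.
have cv : cvgn (series (fun k => `|MR ^+ k *m x|)).
  apply: nondecreasing_is_cvgn; first by apply: nondecreasing_series.
  exists C => _ [K _ <-]; rewrite /series /= big_mkord; exact: CP.
exact: cvg_series_cvg_0 cv.
Qed.

Lemma unstable_cvg0 a : (VR ^+ k *m (a *: v)) @[k --> \oo] --> (0 : 'cV[R]_n.+1).
Proof.
under eq_fun do rewrite -scalemxAr VvX scalerA -exprVn.
have : (a * b^-1 ^+ k) @[k --> \oo] --> a * 0.
  apply: cvgM; first exact: cvg_cst.
  by apply: cvg_expr; rewrite normfV gtr0_norm// invf_lt1.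
by rewrite mulr0 -(scale0r v) => ?; exact: cvgZr_tmp.
Qed.

(** Two lifts that differ by [iv w] are used: one in the contracted hyperplane for positive times,
    one on the expanding line for negative times. *)
Lemma homoclinic_stab (w : 'cV[int]_n.+1) : homoclinic M (pi (Ps (iv w))).
Proof.
split.
  under eq_fun do rewrite toral_iter_posE.
  rewrite -(to_torus0 R n.+1); apply: continuous_cvg; first exact: to_torus_continuous.
  by apply: stable_cvg0; exact: ucoord_stab.
have -> : pi (Ps (iv w)) = pi (- L (iv w) *: v).
  by apply/to_torus_eq; exists w; rewrite scaleNr addrC.
under eq_fun do rewrite toral_iter_negE.
rewrite -(to_torus0 R n.+1); apply: continuous_cvg; first exact: to_torus_continuous.
exact: unstable_cvg0.
Qed.

(** From some time on the forward orbit lifts to a bounded one, which has no unstable part; likewise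
    the backward orbit lifts to one with no stable part. Brought back to time 0, these give two
    lifts of [t] that differ by an integer vector, and the first lift is the stable part of that
    vector. *)
Lemma homoclinicP t : homoclinic M t -> exists w, t = pi (Ps (iv w)).
Proof.
move=> [tpos tneg]; pose t0 := repr t; have tE : t = pi t0 by rewrite to_torus_repr.
have [k1 [y1 [ty1 y1b]]] := orbit_to0_lift
  (fun k => erefl : toral_iter M k.+1%:Z t = toral_map M (toral_iter M k%:Z t)) tpos.
have [|k2 [y2 [ty2 y2b]]] := orbit_to0_lift (A := invmx M) _ tneg.
  by move=> [|k]; [rewrite oppr0|]; rewrite -NegzE// -NegzE.
have Ly1 : L y1 = 0.
  apply/eqP; rewrite -normr_eq0 eq_le normr_ge0 andbT leNgt; apply/negP => Ly1.
  have [C C0 CP] := ucoord_bound lam; have [k] := expr_unbounded b_gt1 (C / `|L y1|).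
  rewrite ltr_pdivrMr// ltNge => /negP; apply.
  have := CP (MR ^+ k *m y1); rewrite ucoordMX normrM normrX (gtr0_norm b_gt0).
  by move/le_trans; apply; rewrite ler_piMr.
have Py2 : Ps y2 = 0.
  apply/eqP; rewrite -normr_eq0 eq_le normr_ge0 andbT leNgt; apply/negP => Py2.
  have [C C0 CP] := stab_uniform_sum.
  (* With this choice of vectors every term of the bounded sum is the norm of [Ps y2]. *)
  have := CP (fun j => VR ^+ j *m y2) 1 y2b.
  move=> H; have := H (Num.truncn (C / `|Ps y2|)).+1.
  under eq_bigr do rewrite stabV MVRX.
  rewrite sumr_const card_ord mulr1 leNgt => /negP; apply.
  by rewrite -mulr_natl -ltr_pdivrMr// truncnS_gt.
have [l1 E1] : exists l, t0 = VR ^+ k1 *m y1 + iv l.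
  move: ty1; rewrite tE toral_iter_posE => /to_torus_eq[l E].
  exists (invmx M ^+ k1 *m l); rewrite -VRX_iv -mulmxDr -E VMRX//.
have [l2 E2] : exists l, t0 = MR ^+ k2 *m y2 + iv l.
  move: ty2; rewrite tE toral_iter_negE => /to_torus_eq[l E].
  exists (M ^+ k2 *m l); rewrite -MRX_iv -mulmxDr -E MVRX//.
exists (l2 - l1); rewrite tE.
have Ls : L (VR ^+ k1 *m y1) = 0 by rewrite ucoordVX Ly1 mul0r.
rewrite [in LHS]E1; apply/to_torus_eq; exists l1; congr (_ + _).
rewrite -[LHS](stab_id Ls) map_mxB.
have -> : VR ^+ k1 *m y1 = MR ^+ k2 *m y2 + (iv l2 - iv l1).
  by apply: (addIr (iv l1)); rewrite -E1 E2 -addrA subrK.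
by rewrite stabD stabM Py2 mulmx0 add0r.
Qed.

(** The stable parts differ by an integer vector killed by [lam], hence coincide; then [w - w'] is
    an integer vector on the expanding line, hence 0. *)
Lemma lattice_stab_inj w w' : pi (Ps (iv w)) = pi (Ps (iv w')) -> w = w'.
Proof.
move=> /to_torus_eq[l E].
have lam0 : lam <> 0.
  by move=> l0; have := lamv; rewrite l0 /ucoord mul0mx mxE => /esym/eqP; rewrite oner_eq0.
have l0 : l = 0.
  apply/eqP/negPn/negP => l0; apply: lam0.
  apply: (left_eigen_int_inj M_pisot lamM l0); apply: ucoord_eq0.
  by rewrite -(addKr (Ps (iv w')) (iv l)) -E addrC ucoordB !ucoord_stab subrr.
apply/eqP; rewrite -subr_eq0; apply/eqP.
apply: (eigen_line_int M_pisot (c := L (iv (w - w'))) Mv).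
have := stab_decomp lam v (iv (w - w')).
by rewrite {2}map_mxB stabB E l0 map_mx0 addr0 subrr add0r.
Qed.

(** The homoclinic points whose integer vector has unstable coordinate in [L (iv n0)] times [Z[b]]
    form a subgroup. It contains the orbit of [t], negative times included because [b] is a unit, so
    by fundamentality it contains all homoclinic points; [lattice_stab_inj] then reads the result
    back on [w]. *)
Lemma fundamental_homoclinicP t : fundamental_homoclinic M t ->
  exists n0, t = pi (Ps (iv n0)) /\
    forall w, exists2 z, Z_adjoin b z & L (iv w) = L (iv n0) * z.
Proof.
move=> [/homoclinicP[n0 tE] gen]; exists n0; split=> // w.
pose H : set (torus R n.+1) :=
  [set x | exists w, x = pi (Ps (iv w)) /\ exists2 z, Z_adjoin b z & L (iv w) = L (iv n0) * z].
have ZX k : Z_adjoin b (b ^+ k).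
  by exists 'X^k => //; rewrite map_polyXn hornerXn.
have ZV k : Z_adjoin b (b ^- k).
  elim: k => [|k IH]; first by rewrite invr1; exact: (Z_adjoin_int b 1).
  by rewrite exprSr invfM; apply: (Z_adjoin_div M_pisot).
have Hsub : subgroup_set H.
  split.
    exists 0; rewrite map_mx0 stab_id ?ucoord0// to_torus0; split=> //.
    by exists 0; [exact: (Z_adjoin_int b 0)|rewrite mulr0].
  move=> _ _ [w1 [-> [z1 z1Z w1z]]] [w2 [-> [z2 z2Z w2z]]]; exists (w1 - w2).
  rewrite map_mxB stabB (to_torusB (Ps (iv w1))); split=> //; exists (z1 - z2).
    by apply: Z_adjoinD => //; exact: Z_adjoinN.
  by rewrite ucoordB w1z w2z mulrBr.
have /(_ H Hsub) sub := @smallest_sub _ (@subgroup_set R n.+1) [set toral_iter M k t | k in setT].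
have : H (pi (Ps (iv w))).
  apply: sub; last by rewrite -/(generated_subgroup _) gen; exact: homoclinic_stab.
  move=> _ [k _ <-]; rewrite tE; case: k => k.
    exists (M ^+ k *m n0); rewrite toral_iter_posE -stabM MRX_iv; split=> //.
    by exists (b ^+ k) => //; rewrite -MRX_iv ucoordMX mulrC.
  exists (invmx M ^+ k.+1 *m n0); rewrite NegzE toral_iter_negE -stabV VRX_iv; split=> //.
  by exists (b ^- k.+1) => //; rewrite -VRX_iv ucoordVX.
by move=> [w' [/lattice_stab_inj <-]].
Qed.

End PisotSplitting.

(** * Haar measure of thin boxes *)

Section Measure.
Context (R : realType) (n : nat).
Local Notation iv := (map_mx intr : 'cV[int]_n.+1 -> 'cV[R]_n.+1).
Local Notation pi := (@to_torus R n.+1).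
Context (lam : 'rV[R]_n.+1) (v : 'cV[R]_n.+1) (lamv : ucoord lam v = 1).
Local Notation L := (ucoord lam).
Local Notation Ps := (stab lam v).
Context (mu : probability (torus R n.+1) R) (mu_haar : is_haar mu).

Lemma torus_open_measurable (A : set (torus R n.+1)) : open A -> measurable A.
Proof. by move=> oA; exact: sub_sigma_algebra. Qed.

Lemma additive_continuous (V W : normedModType R) (f : V -> W) C :
  (forall x y, f (x - y) = f x - f y) -> (forall x, `|f x| <= C * `|x|) -> continuous f.
Proof.
move=> fB fC x; apply/cvgrPdist_lt => e e0.
have C1 : 0 < `|C| + 1 by rewrite ltr_wpDl.
near=> y; rewrite -fB; apply: le_lt_trans (fC _) _.
have : `|x - y| < e / (`|C| + 1).
  by near: y; apply: cvgr_dist_lt; [exact: cvg_id|rewrite divr_gt0].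
rewrite ltr_pdivlMr// => H; apply: le_lt_trans H.
by rewrite mulrC ler_wpM2l//; have := ler_norm C; lra.
Unshelve. all: by end_near. Qed.

(** For unimodular [A], the image under [A] of a stable ball times an unstable interval. The sign
    before [L] fits the codes, whose lifts have minus the tail value as unstable coordinate. *)
Definition box (A : 'M[int]_n.+1) (r a c : R) : set 'cV[R]_n.+1 :=
  [set p | `|Ps (map_mx intr (invmx A) *m p)| < r /\
           a < - L (map_mx intr (invmx A) *m p) < c].

Lemma box_open A r a c : open (box A r a c).
Proof.
have [C1 C10 C1P] := mulmx_bound (map_mx intr (invmx A) : 'M[R]_n.+1).
have [C2 C20 C2P] := ucoord_bound lam.
set W := (map_mx intr (invmx A) : 'M[R]_n.+1) in C1P *.
have cL : continuous (fun p : 'cV[R]_n.+1 => - L (W *m p) : R).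
  apply: (@additive_continuous _ _ _ (C2 * C1)) => [x y|x].
    by rewrite mulmxBr ucoordB opprB opprK addrC.
  by rewrite normrN -mulrA; apply: le_trans (C2P _) _; rewrite ler_wpM2l.
have cP : continuous (fun p : 'cV[R]_n.+1 => Ps (W *m p)).
  apply: (@additive_continuous _ _ _ (C1 + C2 * C1 * `|v|)) => [x y|x].
    by rewrite mulmxBr stabB.
  rewrite /stab; apply: le_trans (ler_normB _ _) _; rewrite mulrDl lerD//.
  rewrite normrZ mulrAC ler_wpM2r// -mulrA; apply: le_trans (C2P _) _.
  by rewrite ler_wpM2l.
have -> : box A r a c = (fun p => Ps (W *m p)) @^-1` (ball 0 r) `&`
   ((fun p => - L (W *m p)) @^-1` [set x | a < x] `&`
    (fun p => - L (W *m p)) @^-1` [set x | x < c]).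
  apply/seteqP; split=> p; rewrite /box /= -ball_normE /= sub0r normrN.
    by move=> [-> /andP[-> ->]].
  by move=> [-> [-> ->]].
apply: openI; [|apply: openI].
- by apply: open_comp => [x _|]; [exact: cP|exact: ball_open].
- by apply: open_comp => [x _|]; [exact: cL|exact: open_gt].
- by apply: open_comp => [x _|]; [exact: cL|exact: open_lt].
Qed.

Lemma torus_box_measurable A r a c : measurable (pi @` box A r a c).
Proof. by apply: torus_open_measurable; apply: to_torus_open; exact: box_open. Qed.

Lemma torus_box_translate A r a c d : A \in unitmx ->
  pi @` box A r (a + d) (c + d) =
  [set pi (- d *: (map_mx intr A *m v)) + x | x in pi @` box A r a c].
Proof.
move=> AU; have VA (x : 'cV[R]_n.+1) : map_mx intr (invmx A) *m (map_mx intr A *m x) = x.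
  by rewrite mulmxA -map_mxM mulVmx// map_mx1 mul1mx.
have shift p d' : map_mx intr (invmx A) *m (p + d' *: (map_mx intr A *m v)) =
    map_mx intr (invmx A) *m p + d' *: v by rewrite mulmxDr -scalemxAr VA.
apply/seteqP; split=> z /=.
  move=> [p [p1 p2] <-]; exists (pi (p + d *: (map_mx intr A *m v))).
    exists (p + d *: (map_mx intr A *m v)) => //; split; rewrite shift.
      by rewrite stabD (stab_v lamv) addr0.
    by rewrite ucoordD ucoordZ lamv mulr1; lra.
  by rewrite -to_torusD scaleNr addrC addrK.
move=> [_ [p [p1 p2] <-] <-]; exists (p + - d *: (map_mx intr A *m v)).
  split; rewrite shift; first by rewrite stabD (stab_v lamv) addr0.
  by rewrite ucoordD ucoordZ lamv mulr1; lra.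
by rewrite addrC to_torusD.
Qed.

(* Slicing the box along its unstable side gives translates that cover each
   point boundedly often, since a bounded box contains boundedly many points
   of a coset of the lattice. *)
Lemma torus_box_multiplicity (r : R) : exists C : nat, forall A (a s : R) (k : nat), A \in unitmx ->
  0 < s -> k%:R * s <= 1 -> forall z : torus R n.+1,
  (\sum_(i < k) (z \in pi @` box A r (a + i%:R * s) (a + s + i%:R * s)) <= C)%N.
Proof.
(* After the inverse of [A] is applied, points over [z] in two slices differ by an integer vector
   with stable part at most [r + r] and unstable coordinate at most 1, as all slices together have
   side [k * s <= 1]. This bound does not involve [A]. *)
have [ls lsP] := @int_vec_finite R n.+1 (r + r + `|v|).
exists (size ls) => A a s k AU s0 ks z.
set W := (map_mx intr (invmx A) : 'M[R]_n.+1).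
pose I := [seq i : 'I_k <- enum 'I_k | z \in pi @` box A r (a + i%:R * s) (a + s + i%:R * s)].
have -> : (\sum_(i < k) (z \in pi @` box A r (a + i%:R * s) (a + s + i%:R * s)) = size I)%N.
  rewrite size_filter -sum1_count [RHS]big_mkcond [RHS]big_enum /=.
  by apply: eq_bigr => i _; case: (z \in _).
have [->//|[i0 i0I]] : I = [::] \/ exists i0, i0 \in I.
  by case: I => [|i0 I']; [left|right; exists i0; rewrite mem_head].
have /choice[p pP] : forall i : 'I_k, exists p : 'cV[R]_n.+1, i \in I ->
    box A r (a + i%:R * s) (a + s + i%:R * s) p /\ pi p = z.
  move=> i; have [iI|iI] := boolP (i \in I); last by exists 0.
  by move: (iI); rewrite mem_filter => /andP[/set_mem[p pb pz] _]; exists p.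
have [pb0 pz0] := pP _ i0I.
have /choice[l lP] : forall i : 'I_k, exists l : 'cV[int]_n.+1, i \in I ->
    W *m p i = W *m p i0 + iv l.
  move=> i; have [iI|iI] := boolP (i \in I); last by exists 0.
  have [_ pz] := pP _ iI; have /to_torus_eq[l ->] : pi (p i) = pi (p i0) by rewrite pz.
  by exists (invmx A *m l) => _; rewrite mulmxDr map_mxM.
have Iuniq : uniq I by rewrite filter_uniq// enum_uniq.
rewrite -(size_map l); apply: uniq_leq_size.
  rewrite map_inj_in_uniq// => i j iI jI lij.
  have Wij : W *m p i = W *m p j by rewrite (lP _ iI) (lP _ jI) lij.
  have [[_ bi] _] := pP _ iI; have [[_ bj] _] := pP _ jI.
  rewrite -/W Wij in bi; rewrite -/W in bj.
  have ij : (i < j.+1)%N by rewrite -(ltr_nat R) -natr1 -(ltr_pM2r s0); lra.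
  have ji : (j < i.+1)%N by rewrite -(ltr_nat R) -natr1 -(ltr_pM2r s0); lra.
  by apply/val_inj/eqP; rewrite eqn_leq; apply/andP.
move=> _ /mapP[i iI ->]; apply: lsP.
have [[Pi bi] _] := pP _ iI; have [P0 b0] := pb0; rewrite -/W in Pi bi P0 b0.
have ivE : iv (l i) = W *m p i - W *m p i0 by rewrite (lP _ iI) addrAC subrr add0r.
rewrite (stab_decomp lam v (iv _)) ivE stabB ucoordB.
apply: le_trans (ler_normD _ _) _; apply: lerD.
  by apply: le_trans (ler_normB _ _) _; apply: lerD; exact: ltW.
rewrite normrZ ler_piMl//.
have le1 (j : 'I_k) : 0 <= j%:R * s /\ s + j%:R * s <= 1.
  split; first by rewrite mulr_ge0// ltW.
  apply: le_trans ks; rewrite addrC -[X in _ + X]mul1r -mulrDl ler_pM2r//.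
  by rewrite natr1 ler_nat.
by have := le1 i; have := le1 i0; rewrite ler_norml; lra.
Qed.

(** With [k] the integer part of [1 / s], the [k] slices have equal measure, and integrating their
    multiplicity bounds the total by [C0]. As [k * s] is at least one half, each slice has measure
    at most [2 * C0 * s]. The successor in the constant covers [s >= 1]. *)
Lemma torus_box_measure (r : R) : exists C : nat, forall A a s, A \in unitmx ->
  0 < s -> (mu (pi @` box A r a (a + s)) <= (C%:R * s)%:E)%E.
Proof.
have [C0 CP] := torus_box_multiplicity r; exists (C0 * 2).+1 => A a s AU s0.
have mu1 : (mu (pi @` box A r a (a + s)) <= 1)%E.
  by apply: probability_le1; exact: torus_box_measurable.
have C0s : 1 <= (C0 * 2).+1%:R :> R by rewrite ler1n.
have [s1|s1] := leP 1 s.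
  by apply: le_trans mu1 _; rewrite lee_fin mulr_ege1.
pose k := Num.truncn s^-1.
have sV1 : 1 <= s^-1 by rewrite invf_ge1// ltW.
have /andP[k1 k2] := truncn_itv (le_trans ler01 sV1); rewrite -/k -natr1 in k1 k2.
have k0 : (0 < k)%N by rewrite truncn_gt0.
have ks : k%:R * s <= 1 by rewrite -ler_pdivlMr// mul1r.
have sk : 1 <= k%:R * s * 2.
  have : s^-1 * s <= (k%:R + 1) * s by rewrite ler_pM2r// ltW.
  rewrite mulVf ?gt_eqF// mulrDl mul1r => h.
  have : 1%:R * s <= k%:R * s by rewrite ler_pM2r// ler_nat.
  lra.
pose F (i : nat) := pi @` box A r (a + i%:R * s) (a + s + i%:R * s).
have mF i : measurable (F i) by exact: torus_box_measurable.
have muF i : mu (F i) = mu (pi @` box A r a (a + s)).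
  rewrite /F torus_box_translate// mu_haar//; exact: torus_box_measurable.
have sumF : (\sum_(i < k) mu (F i) <= C0%:R%:E)%E.
  have -> : (\sum_(i < k) mu (F i) =
      \int[mu]_z (\sum_(i < k) (\1_(F i) z)%:E))%E.
    rewrite ge0_integral_sum//=.
    - by apply: eq_bigr => i _; rewrite integral_indic// setIT.
    - by move=> i; exact/measurable_EFinP/measurable_indic.
  apply: (@le_trans _ _ (\int[mu]_z (C0%:R%:E : \bar R))%E).
    apply: ge0_le_integral => //.
    - by move=> z _; apply: sume_ge0 => i _; rewrite lee_fin.
    - apply: emeasurable_sum => i; exact/measurable_EFinP/measurable_indic.
    - move=> z _; rewrite sumEFin lee_fin /indic -natr_sum ler_nat.
      exact: CP.
  by rewrite integral_cst//= probability_setT mule1.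
have muE : mu (pi @` box A r a (a + s)) \is a fin_num.
  by apply: fin_num_measure; exact: torus_box_measurable.
move: sumF; under eq_bigr do rewrite muF -(fineK muE).
rewrite sumEFin lee_fin sumr_const card_ord => H.
rewrite -(fineK muE) lee_fin.
have m0 : 0 <= fine (mu (pi @` box A r a (a + s))) by exact: fine_ge0.
rewrite -natr1 natrM; move: (fine _) m0 H => m m0 H.
have : m <= m * (k%:R * s * 2) by rewrite ler_peMr.
have : k%:R * m * (s * 2) <= C0%:R * (s * 2).
  by rewrite mulr_natl ler_wpM2r// mulr_ge0// ltW.
lra.
Qed.

Lemma negligible_of_small (X : set (torus R n.+1)) :
  (forall eps : R, 0 < eps -> exists U, [/\ measurable U, X `<=` U & (mu U <= eps%:E)%E]) ->
  mu.-negligible X.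
Proof.
move=> H; have /choice[U UP] : forall k : nat, exists U,
    [/\ measurable U, X `<=` U & (mu U <= (k.+1%:R^-1)%:E)%E].
  by move=> k; apply: H; rewrite invr_gt0.
have mU : measurable (\bigcap_k U k) by apply: bigcap_measurable => // k _; have [] := UP k.
exists (\bigcap_k U k); split=> //; last by move=> x Xx k _; have [_ + _] := UP k; apply.
apply/eqP; rewrite eq_le measure_ge0 andbT; apply/lee_addgt0Pr => e e0; rewrite add0e.
have [k kP] : exists k : nat, k.+1%:R^-1 <= e.
  exists (Num.truncn e^-1); rewrite -[leRHS]invrK lef_pV2 ?posrE ?invr_gt0//.
  by rewrite ltW// truncnS_gt.
have [mUk _ muUk] := UP k; apply: le_trans (_ : _ <= mu (U k))%E _.
  by apply: le_measure; rewrite ?inE//; exact: bigcap_inf.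
by apply: le_trans muUk _; rewrite lee_fin.
Qed.

(** Boxes are open whereas the covering intervals are half open: each is extended to the left by its
    own length, whence the factor 2. *)
Lemma finite_cover_measure (A : 'M[int]_n.+1) (r : R) (C : nat) (s : seq (R * R)) :
  A \in unitmx -> (forall a d, 0 < d -> (mu (pi @` box A r a (a + d)) <= (C%:R * d)%:E)%E) ->
  (forall u, u \in s -> 0 < u.2) ->
  exists U, [/\ measurable U,
    forall p u, u \in s -> `|Ps (map_mx intr (invmx A) *m p)| < r ->
      u.1 <= - L (map_mx intr (invmx A) *m p) < u.1 + u.2 -> U (pi p) &
    (mu U <= (C%:R * 2 * \sum_(u <- s) u.2)%:E)%E].
Proof.
move=> AU muC; elim: s => [_|u s IH sP].
  by exists set0; split=> //; rewrite measure0 big_nil mulr0.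
have [|U [mU UP muU]] := IH; first by move=> w ws; apply: sP; rewrite inE ws orbT.
have u0 := sP u (mem_head _ _).
have mB := torus_box_measurable A r (u.1 - u.2) (u.1 - u.2 + 2 * u.2).
exists (pi @` box A r (u.1 - u.2) (u.1 - u.2 + 2 * u.2) `|` U); split.
- exact: measurableU.
- move=> p w; rewrite inE => /orP[/eqP ->|ws] pr pu; last by right; apply: UP pu.
  by left; exists p => //; split=> //; lra.
- apply: le_trans (measureU2 mu mB mU) _; rewrite big_cons mulrDr EFinD; apply: leeD => //.
  by apply: le_trans (muC _ _ _) _; rewrite ?mulr_gt0// lee_fin mulrA.
Qed.

End Measure.

HB.instance Definition _ (R : realType) (m n : nat) :=
  Complete.on 'M[R]_(m, n).

(** * Series weighted by digits, and compactness of codes *)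

Section WeightedSeries.
Context (R : realType) (V : completeNormedModType R).
Implicit Types (u : nat -> V) (c : nat -> nat).

Definition wsum u c : V := limn (series (fun k => (c k)%:R *: u k)).

Context (u : nat -> V) (S : R) (B : nat).
Context (uS : forall K, \sum_(k < K) `|u k| <= S).

Let cvg_nseries c : (forall k, (c k <= B)%N) -> cvgn [normed series (fun k => (c k)%:R *: u k)].
Proof.
move=> cB; apply: nondecreasing_is_cvgn.
  apply: nondecreasing_series => k _ _; exact: normr_ge0.
exists (B%:R * S) => _ [K _ <-]; rewrite /normed_series_of /series /= big_mkord.
apply: (@le_trans _ _ (\sum_(k < K) B%:R * `|u k|)).
  by apply: ler_sum => k _; rewrite normrZ normr_nat ler_wpM2r// ler_nat.
by rewrite -mulr_sumr ler_wpM2l.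
Qed.

Lemma wsum_cvg c : (forall k, (c k <= B)%N) ->
  series (fun k => (c k)%:R *: u k) @ \oo --> wsum u c.
Proof. by move=> cB; exact/normed_cvg/cvg_nseries. Qed.

Lemma wsum_le c : (forall k, (c k <= B)%N) -> `|wsum u c| <= B%:R * S.
Proof.
move=> cB; apply: le_trans (lim_series_norm (cvg_nseries cB)) _.
apply: limr_le; first exact: cvg_nseries.
near=> K; rewrite /normed_series_of /series /= big_mkord.
apply: (@le_trans _ _ (\sum_(k < K) B%:R * `|u k|)).
  by apply: ler_sum => k _; rewrite normrZ normr_nat ler_wpM2r// ler_nat.
by rewrite -mulr_sumr ler_wpM2l.
Unshelve. all: by end_near. Qed.

Lemma wsum0 : wsum u (fun=> 0%N) = 0.
Proof.
rewrite /wsum (_ : series _ = cst 0) ?lim_cst//.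
by apply/funext => K; rewrite /series /= big1// => k _; rewrite scale0r.
Qed.

(** Uniform continuity for the product topology on bounded codes: the tail of the series of norms
    controls the terms in which the codes may differ. *)
Lemma wsum_agree e : 0 < e -> exists J, forall c c',
  (forall k, (c k <= B)%N) -> (forall k, (c' k <= B)%N) ->
  (forall k, (k < J)%N -> c k = c' k) -> `|wsum u c - wsum u c'| <= e.
Proof.
move=> e0; have cvu : cvgn (series (fun k => `|u k|)).
  apply: nondecreasing_is_cvgn; first by apply: nondecreasing_series.
  by exists S => _ [K _ <-]; rewrite /series /= big_mkord.
pose e' := e / (B%:R + 1).
have B1 : 0 < B%:R + 1 :> R by rewrite ltr_wpDl.
have e'0 : 0 < e' by rewrite divr_gt0.
have [J JP] : exists J, forall K, (J <= K)%N -> \sum_(J <= k < K) `|u k| <= e'.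
  have /cvgrPdist_lt/(_ _ e'0)[J _ JP] := cvu.
  set l := limn _ in JP.
  have up K : series (fun k => `|u k|) K <= l.
    apply: nondecreasing_cvgn_le => //; by apply: nondecreasing_series.
  exists J => K JK; have := JP J (leqnn J); rewrite /=.
  have : series (fun k => `|u k|) K = series (fun k => `|u k|) J + \sum_(J <= k < K) `|u k|.
    by rewrite /series /= -big_cat_nat.
  by have := up K; have := ler_norm (l - series (fun k => `|u k|) J); lra.
exists J => c c' cB c'B cc'.
have cv : series (fun k => (c k)%:R *: u k) K - series (fun k => (c' k)%:R *: u k) K
    @[K --> \oo] --> wsum u c - wsum u c'.
  by apply: cvgB; exact: wsum_cvg.
rewrite -(cvg_lim (@Rhausdorff R) (cvg_norm cv)); apply: limr_le.
  by apply: cvgP; exact: cvg_norm cv.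
near=> K; have JK : (J <= K)%N by near: K; exists J.
rewrite /series /= -sumrB (big_cat_nat (n := J))//= big_nat big1 ?add0r; last first.
  by move=> k /andP[_ kJ]; rewrite cc'// subrr.
apply: le_trans (ler_norm_sum _ _ _) _.
apply: (@le_trans _ _ (B%:R * \sum_(J <= k < K) `|u k|)).
  rewrite mulr_sumr; apply: ler_sum => k _.
  rewrite -scalerBl normrZ ler_wpM2r// ler_norml.
  have := cB k; have := c'B k; rewrite -!(ler_nat R).
  by have : 0 <= (c k)%:R :> R by []; have : 0 <= (c' k)%:R :> R by []; lra.
apply: (@le_trans _ _ (B%:R * e')); first by rewrite ler_wpM2l// JP.
by rewrite /e' mulrA ler_pdivrMr// mulrC ler_wpM2l ?(ltW e0)// lerDl.
Unshelve. all: by end_near. Qed.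

Lemma wsumS c : (forall k, (c k <= B)%N) ->
  wsum u c = (c 0%N)%:R *: u 0%N + wsum (fun k => u k.+1) (fun k => c k.+1).
Proof.
move=> cB; have H := wsum_cvg cB.
have : series (fun k => (c k.+1)%:R *: u k.+1) K @[K --> \oo] -->
    wsum u c - (c 0%N)%:R *: u 0%N.
  have -> : (fun K => series (fun k => (c k.+1)%:R *: u k.+1) K) =
      (fun K => series (fun k => (c k)%:R *: u k) K.+1 - (c 0%N)%:R *: u 0%N).
    by apply/funext => K; rewrite /series /= big_nat_recl// addrC addKr.
  apply: cvgB; last exact: cvg_cst.
  by rewrite cvg_shiftS.
by move=> /(cvg_lim (@norm_hausdorff _ _)) E; rewrite /wsum E addrC subrK.
Qed.

Lemma wsum_lin (W : completeNormedModType R) (f : V -> W) C c :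
  (forall x y, f (x + y) = f x + f y) -> (forall a x, f (a *: x) = a *: f x) ->
  (forall x, `|f x| <= C * `|x|) -> (forall k, (c k <= B)%N) ->
  f (wsum u c) = limn (series (fun k => (c k)%:R *: f (u k))).
Proof.
move=> fD fZ fC cB; have f0 : f 0 = 0 by rewrite -(scale0r 0) fZ scale0r.
have -> : series (fun k => (c k)%:R *: f (u k)) =
    f \o series (fun k => (c k)%:R *: u k).
  apply/funext => K; rewrite /series /= (big_morph f fD f0).
  by apply: eq_bigr => k _; rewrite fZ.
symmetry; apply: (cvg_lim (@norm_hausdorff _ _)).
apply/cvgrPdist_lt => e e0; have C1 : 0 < `|C| + 1 by rewrite ltr_wpDl.
have /cvgrPdist_lt/(_ (e / (`|C| + 1))) := wsum_cvg cB.
move=> /(_ (divr_gt0 e0 C1)); apply: filterS => K; rewrite ltr_pdivlMr// => KP.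
have fB x y : f (x - y) = f x - f y by rewrite fD -scaleN1r fZ scaleN1r.
rewrite /= -fB; apply: le_lt_trans (fC _) _; apply: le_lt_trans KP.
rewrite mulrC ler_wpM2l//; have := ler_norm C; lra.
Qed.

End WeightedSeries.

(** Along an ultrafilter finer than the filter at infinity each digit, having finitely many values,
    is constant on a member; finitely many members meet beyond any rank. *)
Lemma bounded_codes_cluster (B : nat) (E : nat -> int -> nat) :
  (forall N k, (E N k <= B)%N) ->
  exists e : int -> nat, (forall k, (e k <= B)%N) /\
    forall J N0, exists2 N, (N0 <= N)%N & forall k : int, (`|k| <= J)%N -> E N k = e k.
Proof.
move=> EB; have [U [UU Usub]] := @ultraFilterLemma nat \oo _.
have PU : ProperFilter U by exact: ultra_proper.
have lim k : exists a, U [set N | E N k = a].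
  have : U [set N | (E N k <= B)%N] by apply: filterS filterT => N _; exact: EB.
  elim: (B) => [UB|a IH UB].
    by exists 0%N; apply: filterS UB => N /=; rewrite leqn0 => /eqP.
  have [Ua|Ua] := in_ultra_setVsetC [set N | E N k = a.+1] UU; first by exists a.+1.
  apply: IH; apply: filterS (filterI UB Ua) => N [/= ale ane].
  by rewrite leq_eqVlt in ale; case/orP: ale => [/eqP|].
have /choice[e eP] := lim.
exists e; split=> [k|J N0].
  by have [N /= <-] := filter_ex (eP k).
have UJ : U [set N | forall k : int, (`|k| <= J)%N -> E N k = e k].
  elim: J => [|J IH].
    by apply: filterS (eP 0) => N /= E0 k k0; have -> : k = 0 by lia.
  apply: filterS (filterI IH (filterI (eP J.+1%:Z) (eP (- J.+1%:Z)))).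
  move=> N [/= H [Hp Hn]] k kJ.
  have [|/eqP->//|/eqP->//] : [\/ (`|k| <= J)%N, k == J.+1%:Z | k == - J.+1%:Z].
    have [kl|kl] := leqP `|k| J; first by constructor 1.
    have [k0|k0] := leP 0 k; [constructor 2|constructor 3]; lia.
  exact: H.
have UN : U [set N | (N0 <= N)%N] by apply: Usub; exists N0.
by have [N [H N0N]] := filter_ex (filterI UJ UN); exists N.
Qed.

(** * Geometry of the coding map *)

Section Coding.
Context (R : realType) (n : nat) (M : 'M[int]_n.+1) (b : R).
Context (M_pisot : pisot_automorphism M b).
Local Notation MR := (map_mx intr M : 'M[R]_n.+1).
Local Notation VR := (map_mx intr (invmx M) : 'M[R]_n.+1).
Local Notation iv := (map_mx intr : 'cV[int]_n.+1 -> 'cV[R]_n.+1).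
Local Notation pi := (@to_torus R n.+1).
Context (lam : 'rV[R]_n.+1) (v : 'cV[R]_n.+1).
Context (lamM : lam *m MR = b *: lam) (Mv : MR *m v = b *: v) (lamv : ucoord lam v = 1).
Context (lam_sum : forall x : 'cV[R]_n.+1, ucoord lam x = 0 ->
  exists C : R, forall K, \sum_(k < K) `|MR ^+ k *m x| <= C).
Local Notation L := (ucoord lam).
Local Notation Ps := (stab lam v).
Context (n0 : 'cV[int]_n.+1) (n0E : L (iv n0) = 1).
Local Notation s0 := (Ps (iv n0)).

Let b_gt1 : 1 < b. Proof. by case: M_pisot => _ _ _ []. Qed.
Let b_gt0 : 0 < b. Proof. exact: lt_trans b_gt1. Qed.
Local Notation B := (Num.truncn b).
Implicit Types (e : int -> nat) (k : int).

Lemma n0_decomp : iv n0 = s0 + v.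
Proof. by rewrite [LHS](stab_decomp lam v) n0E scale1r. Qed.

Definition xcoord (e : int -> nat) (k : int) : R :=
  wsum (fun j => b ^- j.+1 : R) (fun j : nat => e (k + j%:Z)).

Definition ycoord (e : int -> nat) (k : int) : 'cV[R]_n.+1 :=
  wsum (fun j => MR ^+ j *m s0) (fun j : nat => e (k - 1 - j%:Z)).

(** A lift of [T^(k-1)] of the image of [e]. Since [n0] splits as [s0 + v], the digit that leaves
    [xcoord] at time [k] enters [ycoord], and the two changes add up to an integer vector. *)
Definition qpoint e k := - xcoord e k *: v + ycoord e k.

Lemma xweight_sum K : \sum_(j < K) `|b ^- j.+1| <= (b - 1)^-1.
Proof.
have b10 : 0 < b - 1 by rewrite subr_gt0.
have -> : \sum_(j < K) `|b ^- j.+1| = (1 - b ^- K) / (b - 1).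
  elim: K => [|K IH]; first by rewrite big_ord0 expr0 invr1 subrr mul0r.
  have bK : 0 < b ^+ K by rewrite exprn_gt0.
  rewrite big_ord_recr /= IH gtr0_norm ?invr_gt0 ?exprn_gt0// exprS.
  by field; rewrite !gt_eqF.
by rewrite ler_pdivrMr// mulVf ?gt_eqF// lerBlDr lerDl invr_ge0 exprn_ge0 ?(ltW b_gt0).
Qed.

Lemma yweight_sum : exists S, forall K, \sum_(j < K) `|MR ^+ j *m s0| <= S.
Proof. by apply: lam_sum; rewrite ucoord_stab. Qed.

Lemma xcoordS e k : (forall j, (e j <= B)%N) ->
  xcoord e (k + 1) = b * xcoord e k - (e k)%:R.
Proof.
move=> eB; have eB' (j : nat) : (e (k + j%:Z)%R <= B)%N by [].
rewrite {2}/xcoord (wsumS xweight_sum eB') addr0 expr1.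
have -> : wsum (fun j => b ^- j.+2 : R) (fun j => e (k + j.+1%:Z)) = b^-1 * xcoord e (k + 1).
  rewrite /xcoord (@wsum_lin _ _ _ _ B xweight_sum _ (fun x => b^-1 * x) b^-1).
  - rewrite /wsum; congr (limn (series _)); apply/funext => j.
    by rewrite exprS invfM mulrC; congr (_%:R *: _); congr (e _); lia.
  - by move=> x y; rewrite mulrDr.
  - by move=> a x; exact: mulrCA.
  - by move=> x; rewrite normrM gtr0_norm// invr_gt0.
  - by move=> j; exact: eB.
rewrite mulrDr mulVKf ?gt_eqF//.
have -> : (e k)%:R *: b^-1 = (e k)%:R * b^-1 :> R by [].
by rewrite mulrC divfK ?gt_eqF// addrAC subrr add0r.
Qed.

Lemma ycoordS e k : (forall j, (e j <= B)%N) ->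
  ycoord e (k + 1) = MR *m ycoord e k + (e k)%:R *: s0.
Proof.
move=> eB; have [S SP] := yweight_sum; have [C C0 CP] := mulmx_bound MR.
rewrite {1}/ycoord (@wsumS _ _ _ _ B SP); last by move=> j; exact: eB.
rewrite expr0 mul1mx addrC subr0 addrK; congr (_ + _).
rewrite /ycoord (@wsum_lin _ _ _ _ B SP _ (fun x => MR *m x) C _) //.
- rewrite /wsum; congr (limn (series _)); apply/funext => j.
  rewrite exprS -mulmxE mulmxA; congr (_%:R *: _); congr (e _); lia.
- by move=> x y; rewrite mulmxDr.
- by move=> a x; rewrite -scalemxAr.
Qed.

Lemma qpointS e k : (forall j, (e j <= B)%N) ->
  qpoint e (k + 1) = MR *m qpoint e k + iv (n0 *+ e k).
Proof.
move=> eB; rewrite /qpoint xcoordS// ycoordS// mulmxDr -scalemxAr Mv.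
have -> : iv (n0 *+ e k) = (e k)%:R *: s0 + (e k)%:R *: v.
  by rewrite -scalerDr -n0_decomp scaler_nat raddfMn.
move: (MR *m ycoord e k) (s0) => X Y.
by apply/colP => i; rewrite ![in LHS]mxE ![in RHS]mxE; ring.
Qed.

Lemma xcoord_ge0 e k : 0 <= xcoord e k.
Proof.
rewrite /xcoord /wsum.
have [cv|ncv] := pselect (cvgn (series (fun j : nat => (e (k + j%:Z))%:R *: (b ^- j.+1 : R)))).
  apply: limr_ge => //; near=> K; rewrite /series /= sumr_ge0// => j _.
  by apply: mulr_ge0 => //; rewrite invr_ge0 exprn_ge0// ltW.
by rewrite dvgP//.
Unshelve. all: by end_near. Qed.

Lemma xcoord_le e k : (forall j, (e j <= B)%N) -> xcoord e k <= B%:R / (b - 1).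
Proof.
move=> eB; apply: le_trans (ler_norm _) _.
by apply: (wsum_le xweight_sum) => j; exact: eB.
Qed.

Lemma ycoord_le : exists r, forall e k, (forall j, (e j <= B)%N) -> `|ycoord e k| <= r.
Proof.
have [S SP] := yweight_sum; exists (B%:R * S) => e k eB.
by apply: (wsum_le SP) => j; exact: eB.
Qed.

Lemma ucoord_ycoord e k : (forall j, (e j <= B)%N) -> L (ycoord e k) = 0.
Proof.
move=> eB; have [S SP] := yweight_sum; have [C C0 CP] := ucoord_bound lam.
rewrite /ycoord (@wsum_lin _ _ _ _ B SP _ L C _) //.
- rewrite (_ : series _ = cst 0) ?lim_cst//; apply/funext => K.
  rewrite /series /= big1// => j _.
  by rewrite (ucoordMX lamM) ucoord_stab// mulr0 scaler0.
- exact: ucoordD.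
- exact: ucoordZ.
Qed.

Lemma ucoord_qpoint e k : (forall j, (e j <= B)%N) -> L (qpoint e k) = - xcoord e k.
Proof. by move=> eB; rewrite ucoordD ucoordZ lamv mulr1 ucoord_ycoord// addr0. Qed.

Lemma stab_qpoint e k : (forall j, (e j <= B)%N) -> Ps (qpoint e k) = ycoord e k.
Proof. by move=> eB; rewrite /stab ucoord_qpoint// /qpoint addrAC subrr add0r. Qed.

Lemma limn_series_torus (u : nat -> 'cV[R]_n.+1) (c : nat -> nat) (S : R) :
  (forall K, \sum_(j < K) `|u j| <= S) -> (forall j, (c j <= B)%N) ->
  limn (series (fun j => pi (u j) *+ c j)) = pi (wsum u c).
Proof.
move=> uS cB; apply: (cvg_lim (@torus_hausdorff _ _)).
have -> : series (fun j => pi (u j) *+ c j) = pi \o series (fun j => (c j)%:R *: u j).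
  apply/funext => K; rewrite /series /= to_torus_sum; apply: eq_bigr => j _.
  by rewrite scaler_nat to_torusMn.
apply: continuous_cvg; first exact: to_torus_continuous.
exact: wsum_cvg uS _ cB.
Qed.

(** Modulo the lattice [s0] is [- v], so the half of the series with indices [k >= 0] lies on the
    expanding line. The time is 1 because that half gives [e 0] weight 1 where [xcoord e 0] has the
    weight [1 / b]: the sum is [MR *m qpoint e 0]. *)
Lemma phiE e : (forall j, (e j <= B)%N) -> phi M (pi s0) e = pi (qpoint e 1).
Proof.
move=> eB; have [S SP] := yweight_sum.
have -> : qpoint e 1 = MR *m qpoint e 0 + iv (n0 *+ e 0) by rewrite -qpointS// add0r.
rewrite (to_torusD (MR *m _)) to_torus_iv addr0 mulmxDr (to_torusD (MR *m (_ *: _))) /phi.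
congr (_ + _).
  have -> : pi s0 = pi (- v).
    by rewrite /stab n0E scale1r addrC to_torusD to_torus_iv addr0.
  pose u (j : nat) := - (b ^- j) *: v.
  have uS K : \sum_(j < K) `|u j| <= b / (b - 1) * `|v|.
    apply: (@le_trans _ _ (\sum_(j < K) b * `|b ^- j.+1| * `|v|)).
      apply: ler_sum => j _; rewrite /u normrZ normrN ler_wpM2r//.
      have bj : 0 < b ^+ j by rewrite exprn_gt0.
      rewrite !gtr0_norm ?invr_gt0 ?exprn_gt0// exprS invfM mulrA mulfV ?gt_eqF//.
      by rewrite mul1r.
    by rewrite -mulr_suml ler_wpM2r// -mulr_sumr ler_wpM2l ?(ltW b_gt0)// xweight_sum.
  have -> : (fun j : nat => toral_iter M (- j%:Z) (pi (- v)) *+ e j%:Z) =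
      (fun j : nat => pi (u j) *+ e j%:Z).
    apply/funext => j; congr (_ *+ _).
    rewrite toral_iter_negE// mulmxN; congr pi.
    by rewrite (VvX M_pisot Mv) /u scaleNr.
  rewrite (limn_series_torus uS) => [|j]; last exact: eB.
  congr pi.
  have -> : MR *m (- xcoord e 0 *: v) = - b *: (xcoord e 0 *: v).
    by rewrite -scalemxAr Mv !scalerA; congr (_ *: _); ring.
  rewrite /xcoord (@wsum_lin _ _ _ _ B xweight_sum _ (fun x => - b *: (x *: v)) (b * `|v|)).
  - rewrite /wsum; congr (limn (series _)); apply/funext => j; rewrite add0r.
    congr (_ *: _); rewrite /u scalerA; congr (_ *: _).
    by rewrite exprS invfM mulrA mulNr mulfV ?gt_eqF// mulN1r.
  - by move=> x y; rewrite scalerDl scalerDr.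
  - move=> a x; have -> : a *: x = a * x :> R by [].
    by rewrite !scalerA; congr (_ *: _); ring.
  - move=> x; rewrite normrZ normrN gtr0_norm// -mulrA ler_wpM2l ?(ltW b_gt0)//.
    by rewrite mulrC (normrZ x v).
  - by move=> j; exact: eB.
have -> : (fun j : nat => toral_iter M j.+1%:Z (pi s0) *+ e (- j.+1%:Z)) =
    (fun j : nat => pi (MR ^+ j.+1 *m s0) *+ e (- j.+1%:Z)).
  by apply/funext => j; rewrite toral_iter_posE.
rewrite (@limn_series_torus _ _ S); last by move=> j; exact: eB.
  congr pi; have [C C0 CP] := mulmx_bound MR.
  rewrite /ycoord (@wsum_lin _ _ _ _ B SP _ (fun x => MR *m x) C _) //.
  - rewrite /wsum; congr (limn (series _)); apply/funext => j.
    by rewrite exprS -mulmxE mulmxA; congr (_%:R *: _); congr (e _); lia.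
  - by move=> x y; rewrite mulmxDr.
  - by move=> a x; rewrite -scalemxAr.
move=> K; have := SP K.+1; rewrite big_ord_recl; apply: le_trans.
by rewrite lerDr.
Qed.

Lemma beta_compactumP e : beta_compactum b e <->
  (forall j, (e j <= B)%N) /\ (forall k, xcoord e k < 1).
Proof.
have xS k i : (forall j, (e j <= B)%N) ->
    xcoord e (k + i.+1%:Z) = b * xcoord e (k + i%:Z) - (e (k + i%:Z))%:R.
  by move=> eB; rewrite -xcoordS//; congr xcoord; lia.
split=> -[eB]; last first.
  move=> x1; split=> // k; apply: (greedy_lex_lt b_gt1 (x := fun i : nat => xcoord e (k + i%:Z))).
    by move=> i; rewrite xcoord_ge0 x1.
  by move=> i; exact: xS.
move=> elt; split=> // k.
have := @lex_lt_lt1 _ _ b_gt1 (fun i : nat => xcoord e (k + i%:Z)) (fun i : nat => e (k + i%:Z))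
  (B%:R / (b - 1)).
move=> /(_ _ _ _ 0%N); rewrite addr0; apply.
- by move=> i; rewrite xcoord_ge0 xcoord_le.
- by move=> i; exact: xS.
- move=> j; have := elt (k + j%:Z); congr (lex_lt _ _); apply/funext => i.
  by congr (e _); lia.
Qed.

Lemma compactum_xcoordS e k : beta_compactum b e ->
  xcoord e (k + 1) = tau b (xcoord e k) /\ e k = Num.truncn (b * xcoord e k).
Proof.
move=> /beta_compactumP[eB x1]; have xS := xcoordS k eB.
have x0 := xcoord_ge0 e (k + 1); have x'1 := x1 (k + 1).
have bxE : Num.truncn (b * xcoord e k) = e k.
  by apply: truncn_def; rewrite -natr1; lra.
by rewrite bxE tauE ?xcoord_ge0// bxE xS.
Qed.

Lemma compactum_xcoord_iter e k (j : nat) : beta_compactum b e ->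
  xcoord e (k + j%:Z) = iter j (tau b) (xcoord e k).
Proof.
move=> eX; elim: j => [|j IH]; first by rewrite addr0.
have -> : k + j.+1%:Z = k + j%:Z + 1 by lia.
by have [-> _] := compactum_xcoordS (k + j%:Z) eX; rewrite IH.
Qed.

Lemma pi_qpointS e k : (forall j, (e j <= B)%N) ->
  pi (qpoint e (k + 1)) = toral_map M (pi (qpoint e k)).
Proof. by move=> eB; rewrite qpointS// (to_torusD (MR *m _)) to_torus_iv addr0 toral_mapE. Qed.

Lemma pi_qpoint_addn e k (j : nat) : (forall j, (e j <= B)%N) ->
  pi (qpoint e (k + j%:Z)) = pi (MR ^+ j *m qpoint e k).
Proof.
move=> eB; elim: j => [|j IH]; first by rewrite addr0 expr0 mul1mx.
have -> : k + j.+1%:Z = k + j%:Z + 1 by lia.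
by rewrite pi_qpointS// IH toral_mapE mulmxA mulmxE -exprS.
Qed.

Lemma pi_qpoint_subn e k (j : nat) : (forall j, (e j <= B)%N) ->
  pi (qpoint e k) = pi (VR ^+ j *m qpoint e (k + j%:Z)).
Proof.
move=> eB; have := pi_qpoint_addn k j eB.
move=> /(congr1 (iter j (toral_map (invmx M)))); rewrite !iter_toral_mapE => ->.
by rewrite (VMRX M_pisot).
Qed.

Lemma pi_qpoint_eq e e' k : (forall j, (e j <= B)%N) -> (forall j, (e' j <= B)%N) ->
  pi (qpoint e 1) = pi (qpoint e' 1) -> pi (qpoint e k) = pi (qpoint e' k).
Proof.
move=> eB e'B E; have [k1|k1] := leP 1 k.
  have -> : k = 1 + (absz (k - 1))%:Z by lia.
  by rewrite !pi_qpoint_addn// -!iter_toral_mapE E.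
rewrite (pi_qpoint_subn k (absz (1 - k)) eB) (pi_qpoint_subn k (absz (1 - k)) e'B).
have -> : k + (absz (1 - k))%:Z = 1 by lia.
by rewrite -!iter_toral_mapE E.
Qed.

Lemma compactum_tail_eq e e' k : beta_compactum b e -> beta_compactum b e' ->
  xcoord e k = xcoord e' k -> forall i, k <= i -> e i = e' i.
Proof.
move=> eX e'X E i ki; have -> : i = k + (absz (i - k))%:Z by lia.
have [_ ->] := compactum_xcoordS (k + (absz (i - k))%:Z) eX.
have [_ ->] := compactum_xcoordS (k + (absz (i - k))%:Z) e'X.
by rewrite !compactum_xcoord_iter// E.
Qed.

(** At every time the two lifts differ by an integer vector with stable part at most [r + r] and
    unstable coordinate of modulus below 1, hence by one of finitely many, whose unstable
    coordinates form [ds]. A visit of the tail of [e] to the interval forces equal tails [N] steps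
    later; visits arbitrarily far in the past give all digits. *)
Lemma coding_unique : weakly_finitary b -> (forall w, Z_adjoin b (L (iv w))) ->
  exists (p : R) N eta, [/\ 0 <= p < 1, 0 < eta, iter N (tau b) p = 0 &
    forall e e', beta_compactum b e -> beta_compactum b e' ->
      pi (qpoint e 1) = pi (qpoint e' 1) ->
      (forall k0, exists2 k, k <= k0 & p <= xcoord e k < p + eta) -> e = e'].
Proof.
move=> WF LZ; have [r rP] := ycoord_le.
have [s sP] := @int_vec_finite R n.+1 (r + r + `|v|).
pose ds := [seq L (iv l) | l <- s & `|L (iv l)| < 1].
have [z zds|p [N [eta [p01 eta0 pN sync]]]] :=
    synchronising_interval b_gt1 (@Z_adjoin_div _ _ _ _ M_pisot) WF (ds := ds).
  by move: zds => /mapP[l]; rewrite mem_filter => /andP[l1 _] ->; split.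
exists p, N, eta; split=> // e e' eX e'X E freq.
have /beta_compactumP[eB x1] := eX; have /beta_compactumP[e'B x'1] := e'X.
have meet k : p <= xcoord e k < p + eta -> xcoord e (k + N%:Z) = xcoord e' (k + N%:Z).
  move=> /andP[pk kp]; rewrite !compactum_xcoord_iter//.
  have /to_torus_eq[l lE] := pi_qpoint_eq k eB e'B E.
  have x'E : xcoord e' k = xcoord e k + L (iv l).
    have := congr1 L lE; rewrite ucoordD !ucoord_qpoint// => H.
    by apply: (addrI (- xcoord e' k)); rewrite addrA addrAC -H; ring.
  have L1 : `|L (iv l)| < 1.
    have -> : L (iv l) = xcoord e' k - xcoord e k by rewrite x'E addrAC subrr add0r.
    rewrite ltr_norml; have := xcoord_ge0 e k; have := xcoord_ge0 e' k.
    by have := x1 k; have := x'1 k; lra.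
  have ls : l \in s.
    apply: sP; rewrite (stab_decomp lam v (iv l)).
    apply: le_trans (ler_normD _ _) _; apply: lerD.
      have -> : Ps (iv l) = ycoord e k - ycoord e' k.
        by rewrite -!stab_qpoint// -stabB lE addrAC subrr add0r.
      by apply: le_trans (ler_normB _ _) _; rewrite lerD// rP.
    by rewrite normrZ ler_piMl// ltW.
  have := sync (L (iv l)) (xcoord e k - p).
  have -> : p + (xcoord e k - p) = xcoord e k by ring.
  rewrite -x'E => ->//; first by apply: map_f; rewrite mem_filter L1.
    by rewrite subr_ge0 pk ltrBlDl.
  by rewrite xcoord_ge0 x'1.
apply/funext => i; have [k ki /meet kE] := freq (i - N%:Z).
by apply: compactum_tail_eq kE _ _ => //; lia.
Qed.

(** Cylinder lengths are values at [b] of integer polynomials with coefficients bounded by [B]. Each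
    is the unstable coordinate of an integer vector [w] whose stable part is bounded whatever the
    degree, by summability; lengths at most 1 leave finitely many [w], and [kappa] is a lower bound
    for their positive coordinates. *)
Lemma expansion_cover (p eta : R) N : 0 <= p < 1 -> 0 < eta -> iter N (tau b) p = 0 ->
  forall eps : R, 0 < eps -> exists K, exists s : seq (R * R),
  [/\ forall u, u \in s -> 0 < u.2, \sum_(u <- s) u.2 < eps &
      forall x : R, 0 <= x < 1 ->
        (forall j, (j <= K)%N -> ~~ (p <= iter j (tau b) x < p + eta)) ->
        exists2 u, u \in s & u.1 <= x < u.1 + u.2].
Proof.
move=> p01 eta0 pN.
have B1 : (1 <= B)%N by rewrite truncn_gt0 ltW.
pose CC : set R := [set c | 0 < c <= 1 /\ exists (a : nat -> int) J,
  (forall i, `|a i| <= B%:Z) /\ c = \sum_(i < J) (a i)%:~R * b ^+ i].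
have CC1 : CC 1.
  split; first by rewrite ltr01 lexx.
  exists (fun=> 1), 1%N; split; first by move=> i; lia.
  by rewrite big_ord1 expr0 mulr1.
have CC_step c i : CC c -> i%:R < b * c -> CC (Num.min 1 (b * c - i%:R)).
  move=> [/andP[c0 c1] [a [J [aB cE]]]] ic.
  have [le1|gt1] := leP 1 (b * c - i%:R); first exact: CC1.
  split; first by rewrite subr_gt0 ic ltW.
  (* Multiplication by [b] shifts the coefficients, and [- i] becomes the constant one. *)
  exists (fun j => if j is j'.+1 then a j' else - i%:Z), J.+1; split.
    move=> [|j]; last exact: aB.
    suff : (i <= B)%N by lia.
    rewrite -(@natrK R i); apply: le_truncn; apply: le_trans (ltW ic) _.
    by rewrite ler_piMr// ltW.
  rewrite big_ord_recl /= expr0 mulr1 intrN addrC cE mulr_sumr; congr (_ + _).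
  by apply: eq_bigr => j _; rewrite exprS mulrCA.
have [S SP] := yweight_sum.
have [s sP] := @int_vec_finite R n.+1 (B%:R * S + `|v|).
have [kappa kappa0 kP] : exists2 kappa : R, 0 < kappa &
    forall w, w \in s -> 0 < L (iv w) -> kappa <= L (iv w).
  elim: s {sP} => [|w s [k k0 kP]]; first by exists 1.
  have [w0|w0] := ltP 0 (L (iv w)); last first.
    exists k => // w'; rewrite inE => /orP[/eqP ->|]; last exact: kP.
    by rewrite ltNge w0.
  exists (Num.min k (L (iv w))); first by rewrite lt_min k0.
  move=> w'; rewrite inE ge_min => /orP[/eqP -> _|w's w'0]; first by rewrite lexx orbT.
  by rewrite kP.
have CC_itv c : CC c -> kappa <= c <= 1.
  move=> [/andP[c0 c1] [a [J [aB cE]]]]; rewrite c1 andbT.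
  pose w := \sum_(i < J) a i *: (M ^+ i *m n0).
  have wE : iv w = \sum_(i < J) (a i)%:~R *: (MR ^+ i *m iv n0).
    rewrite /w raddf_sum /=; apply: eq_bigr => i _.
    by rewrite map_mxZ MRX_iv.
  have Lw : L (iv w) = c.
    rewrite wE (big_morph _ (ucoordD lam) (ucoord0 lam)) cE; apply: eq_bigr => i _.
    by rewrite ucoordZ (ucoordMX lamM) n0E mulr1.
  rewrite -Lw; apply: kP; last by rewrite Lw.
  apply: sP; rewrite (stab_decomp lam v (iv w)).
  apply: le_trans (ler_normD _ _) _; apply: lerD; last first.
    by rewrite Lw normrZ gtr0_norm// ler_piMl.
  have Ps0 : Ps 0 = 0 by rewrite stab_id ?ucoord0.
  rewrite wE (big_morph _ (stabD lam v) Ps0).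
  apply: le_trans (ler_norm_sum _ _ _) _.
  apply: (@le_trans _ _ (\sum_(i < J) B%:R * `|MR ^+ i *m s0|)).
    apply: ler_sum => i _; rewrite stabZ (stabM lamM Mv) normrZ ler_wpM2r//.
    by rewrite -intr_norm -[B%:R]/((B%:Z)%:~R) ler_int.
  by rewrite -mulr_sumr ler_wpM2l.
exact: (avoid_small b_gt1 kappa0 CC_itv CC_step CC1 p01 eta0 pN).
Qed.

(** With digits 0 before [k], the lift at time [k] lies on the expanding line. *)
Definition greedy_code (x : R) k (i : int) : nat :=
  if k <= i then digit b x `|i - k|%N else 0%N.

Lemma greedy_code_le x k i : 0 <= x < 1 -> (greedy_code x k i <= B)%N.
Proof.
move=> x01; rewrite /greedy_code; case: ifP => // _; rewrite /digit.
apply: le_truncn; rewrite ler_piMr ?(ltW b_gt0)//.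
by have /andP[_ /ltW] := iter_tau_itv b `|i - k|%N x01.
Qed.

(** The series is not summed: its difference with [x] is multiplied by [b] at each step, while both
    orbits stay bounded. *)
Lemma xcoord_greedy x k : 0 <= x < 1 -> xcoord (greedy_code x k) k = x.
Proof.
move=> x01; have eB i := greedy_code_le k i x01; have [x0 _] := andP x01.
set e := greedy_code x k in eB *.
have diff (j : nat) : xcoord e (k + j%:Z) - iter j (tau b) x = b ^+ j * (xcoord e k - x).
  elim: j => [|j IH]; first by rewrite addr0 mul1r.
  have -> : k + j.+1%:Z = k + j%:Z + 1 by lia.
  rewrite xcoordS// iter_tauS// exprS -mulrA -IH.
  have -> : e (k + j%:Z) = digit b x j.
    rewrite /e /greedy_code lerDl; congr (digit b x _); lia.
  by ring.
apply/eqP; rewrite -subr_eq0 -normr_eq0 eq_le normr_ge0 andbT leNgt; apply/negP => d0.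
have [j] := expr_unbounded b_gt1 ((B%:R / (b - 1) + 1) / `|xcoord e k - x|).
rewrite ltr_pdivrMr// => jP.
have := congr1 (fun z => `|z|) (diff j); rewrite normrM normrX (gtr0_norm b_gt0) => E.
have := ler_normB (xcoord e (k + j%:Z)) (iter j (tau b) x); rewrite E.
have := iter_tau_itv b j x01; have := xcoord_le (k + j%:Z) eB.
move=> + /andP[t0 t1]; rewrite (ger0_norm t0) (ger0_norm (xcoord_ge0 _ _)).
lra.
Qed.

Lemma xcoord_greedy_lt1 x k i : 0 <= x < 1 -> xcoord (greedy_code x k) i < 1.
Proof.
move=> x01; have eB j := greedy_code_le k j x01; have [x0 x1] := andP x01.
set e := greedy_code x k in eB *.
have back (j : nat) : xcoord e (k - j%:Z) < 1.
  elim: j => [|j IH]; first by rewrite subr0 xcoord_greedy.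
  have := xcoordS (k - j.+1%:Z) eB.
  have -> : k - j.+1%:Z + 1 = k - j%:Z by lia.
  have -> : e (k - j.+1%:Z) = 0%N by rewrite /e /greedy_code ifF//; apply/negbTE; lia.
  rewrite subr0 => E; have := xcoord_ge0 e (k - j.+1%:Z).
  rewrite -(ltr_pM2l b_gt0) -E mulr1 => _; exact: lt_trans b_gt1.
have forw (j : nat) : xcoord e (k + j%:Z) = iter j (tau b) x.
  elim: j => [|j IH]; first by rewrite addr0 xcoord_greedy.
  have -> : k + j.+1%:Z = k + j%:Z + 1 by lia.
  rewrite xcoordS// iter_tauS// IH; congr (_ - _%:R).
  rewrite /e /greedy_code lerDl; congr (digit b x _); lia.
have [ki|ki] := leP k i.
  have -> : i = k + (absz (i - k))%:Z by lia.
  by rewrite forw; have /andP[] := iter_tau_itv b (absz (i - k)) x01.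
have -> : i = k - (absz (k - i))%:Z by lia.
exact: back.
Qed.

Lemma ycoord_greedy x k : ycoord (greedy_code x k) k = 0.
Proof.
rewrite /ycoord -[RHS](wsum0 (fun j => MR ^+ j *m s0)); congr wsum.
by apply/funext => j; rewrite /greedy_code ifF//; apply/negbTE; lia.
Qed.

(** A representative in the unit cube is moved by an integer multiple of [n0], whose unstable
    coordinate is 1. The range is chosen so that [- L w] lies in [[0, 1[] and can be expanded. *)
Lemma torus_repr_unstable : exists rho : R, forall p : 'cV[R]_n.+1, exists w : 'cV[R]_n.+1,
  [/\ pi w = pi p, -1 < L w <= 0 & `|w| <= rho].
Proof.
have [C C0 CP] := ucoord_bound lam.
exists (1 + (C + 1) * `|iv n0|) => p.
pose l := \col_i Num.floor (p i 0); pose p' := p - iv l.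
have p'1 : `|p'| <= 1.
  rewrite [leLHS]mx_normrE; apply: bigmax_le => // -[i j] _; rewrite /= ord1 !mxE.
  have := floor_le_tmp (p i 0); have := floorD1_gt (p i 0); rewrite intrD mulr1z.
  by move=> h1 h2; rewrite ler_norml; lra.
pose c := Num.ceil (L p').
have c1 : L p' <= c%:~R < L p' + 1.
  by have := ceil_itv (L p'); rewrite intrD mulrN1z => /andP[]; lra.
have ivc : iv (c *: n0) = c%:~R *: iv n0 by rewrite map_mxZ.
exists (p' - iv (c *: n0)); split.
- by apply/to_torus_eq; exists (- l - c *: n0); rewrite /p' map_mxB map_mxN addrA.
- by rewrite ucoordB ivc ucoordZ n0E mulr1; lra.
- apply: le_trans (ler_normB _ _) _; apply: lerD => //.
  rewrite ivc normrZ ler_wpM2r//.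
  have : `|L p'| <= C by apply: le_trans (CP _) _; rewrite ler_piMr.
  by rewrite !ler_norml; lra.
Qed.

(* Every point is a limit of points with finite integer part: pull it back by
   [T^-N], expand the unstable coordinate of a bounded representative, and push
   forward by [T^N], which contracts the stable error. *)
Lemma coding_surj z : exists e,
  [/\ forall j, (e j <= B)%N, forall k, xcoord e k <= 1 & pi (qpoint e 1) = z].
Proof.
have [rho rhoP] := torus_repr_unstable; set p := repr z.
have /choice[w wP] : forall N : nat, exists w : 'cV[R]_n.+1,
    [/\ pi w = pi (VR ^+ N *m p), -1 < L w <= 0 & `|w| <= rho].
  by move=> N; exact: rhoP.
have x01 N : 0 <= - L (w N) < 1 by have [_ Lw _] := wP N; lra.
(* Starting at [1 - N], the code is carried in [N] steps to time 1, where [phi] is read. *)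
pose E N := greedy_code (- L (w N)) (1 - N%:Z).
have EB N k : (E N k <= B)%N by exact: greedy_code_le.
have qE N : pi (qpoint (E N) 1) = pi (p - MR ^+ N *m Ps (w N)).
  have -> : qpoint (E N) 1 = qpoint (E N) (1 - N%:Z + N%:Z) by rewrite subrK.
  rewrite pi_qpoint_addn// /qpoint /E xcoord_greedy// ycoord_greedy addr0 opprK.
  have [wp _ _] := wP N.
  have -> : L (w N) *: v = w N - Ps (w N) by rewrite {2}(stab_decomp lam v (w N)) addrC addKr.
  have pE : pi (MR ^+ N *m w N) = pi p.
    by rewrite -iter_toral_mapE wp iter_toral_mapE (MVRX M_pisot).
  by rewrite mulmxBr (to_torusB (MR ^+ N *m w N)) pE -to_torusB.
have [e [eB eP]] := bounded_codes_cluster EB.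
have [S SP] := yweight_sum.
have close (eps : R) : 0 < eps -> exists J : nat, forall e1 e2 (k0 : int),
    (forall j, (e1 j <= B)%N) -> (forall j, (e2 j <= B)%N) ->
    (forall k : int, (`|k| <= J + `|k0|.+1)%N -> e1 k = e2 k) ->
    `|xcoord e1 k0 - xcoord e2 k0| <= eps /\ `|ycoord e1 k0 - ycoord e2 k0| <= eps.
  move=> eps0; have [J1 J1P] := @wsum_agree _ _ (fun j => b ^- j.+1 : R) _ B xweight_sum _ eps0.
  have [J2 J2P] := @wsum_agree _ _ (fun j => MR ^+ j *m s0) _ B SP _ eps0.
  exists (maxn J1 J2) => // e1 e2 k0 e1B e2B e12; split.
    by apply: J1P => [j|j|j jJ]; rewrite ?e1B ?e2B//; apply: e12; lia.
  by apply: J2P => [j|j|j jJ]; rewrite ?e1B ?e2B//; apply: e12; lia.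
exists e; split=> // [k|].
  apply/ler_addgt0Pr => eps eps0; have [J JP] := close _ eps0.
  have [N _ NP] := eP (J + `|k|.+1)%N 0%N.
  have [H _] := JP (E N) e k (EB N) eB NP.
  have := xcoord_greedy_lt1 (1 - N%:Z) k (x01 N).
  rewrite -/(E N); move: H; rewrite ler_norml; lra.
rewrite -(to_torus_repr z) -/p; apply/to_torus_eq.
(* Each precision comes with its own integer vector; closedness of the lattice turns approximate
   membership into membership. *)
have : exists l, qpoint e 1 - p = iv l.
  apply: near_lattice => eps eps0.
  have v1 : 0 < `|v| + 2 by rewrite ltr_wpDl.
  pose e1 := eps / (`|v| + 2) / 2.
  have e10 : 0 < e1 by rewrite !divr_gt0.
  have [J JP] := close _ e10.
  have [N0 N0P] : exists N0, forall N, (N0 <= N)%N -> `|MR ^+ N *m Ps (w N)| <= e1.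
    have [C C0 CP] := stab_uniform_sum lamv lam_sum.
    have wb j : `|w j| <= rho by have [] := wP j.
    have cv : cvgn (series (fun N => `|MR ^+ N *m Ps (w N)|)).
      apply: nondecreasing_is_cvgn; first by apply: nondecreasing_series.
      by exists (C * rho) => _ [K _ <-]; rewrite /series /= big_mkord; exact: CP.
    have /cvgrPdist_le/(_ _ e10)[N0 _ N0P] := cvg_series_cvg_0 cv.
    by exists N0 => N /N0P; rewrite /= sub0r normrN normr_id.
  have [N NN0 NP] := eP (J + `|1%:Z|.+1)%N N0.
  have [Hx Hy] := JP (E N) e 1 (EB N) eB NP.
  have /to_torus_eq[l lE] := qE N; exists l.
  have -> : qpoint e 1 - p - iv l =
      (qpoint e 1 - qpoint (E N) 1) - MR ^+ N *m Ps (w N).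
    by rewrite lE; move: (MR ^+ N *m _) (iv l) (qpoint e 1) => X Y Z; apply/colP => i; rewrite !mxE; ring.
  apply: (@le_lt_trans _ _ (e1 * `|v| + e1 + e1)).
    apply: le_trans (ler_normB _ _) _; apply: lerD; last exact: N0P.
    have -> : qpoint e 1 - qpoint (E N) 1 =
        (xcoord (E N) 1 - xcoord e 1) *: v - (ycoord (E N) 1 - ycoord e 1).
      by rewrite /qpoint; apply/colP => i; rewrite !mxE; ring.
    apply: le_trans (ler_normB _ _) _; apply: lerD => //.
    by rewrite normrZ ler_wpM2r.
  have -> : e1 * `|v| + e1 + e1 = eps / 2 by rewrite /e1; field; rewrite gt_eqF.
  by rewrite ltr_pdivrMr//; lra.
by move=> [l lE]; exists l; rewrite -lE addrC subrK.
Qed.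

(** * Null sets and bijectivity almost everywhere *)

Context (mu : probability (torus R n.+1) R) (mu_haar : is_haar mu).

Lemma qpoint_pullback k : exists2 A, A \in unitmx & forall e, (forall j, (e j <= B)%N) ->
  pi (qpoint e 1) = pi (map_mx intr A *m qpoint e k).
Proof.
have MU : M \in unitmx by case: M_pisot.
have XU (N : 'M[int]_n.+1) (j : nat) : N \in unitmx -> N ^+ j \in unitmx.
  by move=> NU; exact: unitrX.
have [k1|k1] := leP k 1.
  exists (M ^+ absz (1 - k)); first exact: XU.
  move=> e eB; have -> : qpoint e 1 = qpoint e (k + (absz (1 - k))%:Z) by congr (qpoint e _); lia.
  by rewrite pi_qpoint_addn// rmorphXn.
exists (invmx M ^+ absz (k - 1)); first by apply: XU; rewrite unitmx_inv.
move=> e eB; rewrite (pi_qpoint_subn 1 (absz (k - 1)) eB) rmorphXn.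
by congr (pi (_ *m qpoint e _)); lia.
Qed.

(** The time of observation may depend on [eps], because the box estimate is the same for every
    unimodular matrix, in particular for the one that carries that time to time 1. The radius
    [r + 1] makes the bound on stable coordinates strict. *)
Lemma small_xcoord_negligible (X : set (int -> nat)) (k : nat -> int) :
  (forall e, X e -> forall j, (e j <= B)%N) ->
  (forall eps : R, 0 < eps -> exists i, exists s : seq (R * R),
    [/\ forall u, u \in s -> 0 < u.2, \sum_(u <- s) u.2 < eps &
      forall e, X e -> exists2 u, u \in s & u.1 <= xcoord e (k i) < u.1 + u.2]) ->
  mu.-negligible [set pi (qpoint e 1) | e in X].
Proof.
move=> XB cov; apply: negligible_of_small => eps eps0.
have [r rP] := ycoord_le.
have [C muC] := torus_box_measure lamv mu_haar (r + 1).
have C1 : 0 < C%:R * 2 + 1 :> R by rewrite ltr_wpDl// mulr_ge0.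
have [i [s [s0 sS sX]]] := cov (eps / (C%:R * 2 + 1)) (divr_gt0 eps0 C1).
have [A AU AP] := qpoint_pullback (k i).
have [U [mU UP muU]] := finite_cover_measure AU (fun a d => muC A a d AU) s0.
exists U; split=> //.
  move=> _ [e Xe <-]; have eB := XB e Xe; have [u us ux] := sX e Xe.
  rewrite AP//.
  have VA (x : 'cV[R]_n.+1) : map_mx intr (invmx A) *m (map_mx intr A *m x) = x.
    by rewrite mulmxA -map_mxM mulVmx// map_mx1 mul1mx.
  apply: (UP _ u us); rewrite VA.
    rewrite stab_qpoint//.
    by apply: le_lt_trans (rP _ _ eB) _; rewrite ltrDl.
  by rewrite ucoord_qpoint// opprK.
apply: le_trans muU _; rewrite lee_fin; move: sS; rewrite ltr_pdivlMr// => sS.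
have : 0 <= \sum_(u <- s) u.2 by rewrite big_seq sumr_ge0// => u /s0/ltW.
lra.
Qed.

Lemma xcoord1_negligible k :
  mu.-negligible [set pi (qpoint e 1) | e in [set e | (forall j, (e j <= B)%N) /\ xcoord e k = 1]].
Proof.
apply: (small_xcoord_negligible (k := fun=> k)) => [e []//|eps eps0].
exists 0%N, [:: (1, eps / 2)]; split.
- by move=> u; rewrite inE => /eqP ->; rewrite divr_gt0.
- by rewrite big_seq1 /= ltr_pdivrMr//; lra.
- by move=> e [_ ->]; exists (1, eps / 2); rewrite ?mem_head//= lexx ltrDl divr_gt0.
Qed.

(** Seen from time [k0 - K], the tail avoids the interval up to time [k0], that is during the [K]
    steps that the cover requires. *)
Lemma avoiding_negligible (p eta : R) N k0 : 0 <= p < 1 -> 0 < eta ->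
  iter N (tau b) p = 0 ->
  mu.-negligible [set pi (qpoint e 1) | e in
    [set e | beta_compactum b e /\ forall k, k <= k0 -> ~~ (p <= xcoord e k < p + eta)]].
Proof.
move=> p01 eta0 pN.
apply: (small_xcoord_negligible (k := fun i : nat => k0 - i%:Z)) => [e [[]]//|eps eps0].
have [K [s [s0 sS sP]]] :=
  expansion_cover p01 eta0 pN eps0.
exists K, s; split=> // e [eX avoid]; apply: sP.
  have /(beta_compactumP)[_ x1] := eX.
  by rewrite xcoord_ge0 x1.
move=> j jK; rewrite -compactum_xcoord_iter//.
by apply: avoid; lia.
Qed.

Lemma coding_bijective_ae : weakly_finitary b -> (forall w, Z_adjoin b (ucoord lam (iv w))) ->
  {ae mu, forall x, exists! e, beta_compactum b e /\ phi M (pi (stab lam v (iv n0))) e = x}.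
Proof.
move=> WF LZ.
have bcP := beta_compactumP.
have [p [N [eta [p01 eta0 pN uniq]]]] :=
  coding_unique WF LZ.
pose E1 k := [set pi (qpoint e 1) | e in [set e | (forall j, (e j <= B)%N) /\ xcoord e k = 1]].
pose E2 k0 := [set pi (qpoint e 1) | e in
    [set e | beta_compactum b e /\ forall k, k <= k0 -> ~~ (p <= xcoord e k < p + eta)]].
(* A countable union over naturals is enough: the indices [j] and [- j] reach every position for
   [E1], and a code that avoids the interval up to [k0] also does so up to [- |k0|], so [E2] is only
   taken at nonpositive times. *)
apply: (@negligibleS _ _ _ _ (\bigcup_(j : nat) (E1 j%:Z `|` E1 (- j%:Z) `|` E2 (- j%:Z)))).
  move=> x /= nx; apply: contrapT => nE; apply: nx.
  have [e [eB e1 ex]] := coding_surj x.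
  have eX : beta_compactum b e.
    apply/bcP; split=> // k; rewrite lt_neqAle e1 andbT; apply/eqP => k1; apply: nE.
    have [k0|k0] := leP 0 k.
      by exists (absz k) => //; left; left; exists e => //; split=> //; rewrite gez0_abs.
    exists (absz k) => //; left; right; exists e => //; split=> //.
    by rewrite ltz0_abs// opprK.
  have freq k0 : exists2 k, k <= k0 & p <= xcoord e k < p + eta.
    apply: contrapT => H; apply: nE; exists (absz k0) => //; right; exists e => //.
    split=> // k kk0; apply/negP => kJ; apply: H; exists k => //; lia.
  have phiX e' : beta_compactum b e' -> phi M (pi (stab lam v (iv n0))) e' = pi (qpoint e' 1).
    by move=> /bcP[e'B _]; rewrite (phiE).
  exists e; split=> [|e' [e'X e'x]]; first by rewrite phiX.
  by apply: uniq => //; rewrite ex -e'x phiX.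
apply: negligible_bigcup => j; apply: negligibleU; last exact: avoiding_negligible p01 eta0 pN.
by apply: negligibleU; exact: xcoord1_negligible.
Qed.

End Coding.

Theorem theorem9 (R : realType) (m : nat) (M : 'M[int]_m) (b : R)
    (k : 'I_m -> int) (t : torus R m) (mu : probability (torus R m) R) :
  pisot_automorphism M b ->
  is_min_poly (beta_poly k) b ->
  algebraically_conjugate M (beta_mx k) ->
  fundamental_homoclinic M t ->
  weakly_finitary b ->
  is_haar mu ->
  {ae mu, forall x : torus R m,
     exists! e : int -> nat, beta_compactum b e /\ phi M t e = x}.
Proof.
move=> M_pisot _ _ t_fund WF mu_haar; clear k.
case: m M t mu M_pisot t_fund mu_haar => [|n] M t mu M_pisot t_fund mu_haar.
  (* In dimension 0 the characteristic polynomial is 1, which has no root. *)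
  by case: M_pisot => _ _; rewrite /char_poly det_mx00 rmorph1 (negPf (root1 _)).
have [lam [v [g [lamM Mv lamv [gE gb] gW]]]] := spectral_data M_pisot.
have lamv1 : ucoord lam v = 1 by rewrite /ucoord lamv mxE.
have lam_sum (x : 'cV[R]_n.+1) : ucoord lam x = 0 ->
    exists C : R, forall K, \sum_(j < K) `|(map_mx intr M : 'M[R]_n.+1) ^+ j *m x| <= C.
  by move=> Lx; apply: (stable_summable M_pisot gE gb gW); exact: ucoord_eq0.
have [n0 [tE LZ]] := fundamental_homoclinicP M_pisot lamM Mv lamv1 lam_sum t_fund.
set c := ucoord lam (map_mx intr n0) in LZ.
(* Every unstable coordinate of an integer vector is a multiple of [c], so [c = 0] would make [lam]
   vanish on the lattice. *)
have c0 : c != 0.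
  apply/eqP => c0; have lam0 : lam = 0.
    apply: (left_eigen_int_inj M_pisot (w := delta_mx 0 0)) => //.
      by apply/eqP => /matrixP/(_ 0 0); rewrite !mxE.
    by apply: ucoord_eq0; have [z _ ->] := LZ (delta_mx 0 0); rewrite c0 mul0r.
  by move: lamv1; rewrite lam0 /ucoord mul0mx mxE => /esym/eqP; rewrite oner_eq0.
(* Rescale so that [n0] has unstable coordinate 1. *)
have ucE (x : 'cV[R]_n.+1) : ucoord (c^-1 *: lam) x = c^-1 * ucoord lam x.
  by rewrite /ucoord -scalemxAl mxE.
have stE (x : 'cV[R]_n.+1) : stab (c^-1 *: lam) (c *: v) x = stab lam v x.
  by rewrite /stab ucE scalerA mulrAC mulVf// mul1r.
rewrite tE -stE; apply: (@coding_bijective_ae _ _ _ _ M_pisot) => //.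
- by rewrite -scalemxAl lamM scalerA mulrC -scalerA.
- by rewrite -scalemxAr Mv scalerA mulrC -scalerA.
- by rewrite ucE ucoordZ lamv1 mulr1 mulVf.
- move=> x; rewrite ucE => /eqP; rewrite mulf_eq0 invr_eq0 (negPf c0) => /eqP.
  exact: lam_sum.
- by rewrite ucE mulVf.
- by move=> w; have [z zZ zE] := LZ w; rewrite ucE zE mulKf.
Qed.
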